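(* Let $a,b,c,y>0$, $x\ge1$, $u=\lceil a+b+c+y+1\rceil$, and consider the branching process with type set $\mathcal{X}_2=\{\langle k,i\rangle:k\ge0,\ i\in\{1,2\}\}$ whose progeny generating vector has entries, for $i\in\{1,2\}$, $$G_{\langle 0,i\rangle}(\boldsymbol s)=\frac bu s_{\langle0,i\rangle}^u+\frac cu s_{\langle1,i\rangle}^u+\frac yu s_{\langle0,3-i\rangle}^u+1-\frac{b+c+y}{u},$$ and, for $k\ge1$, $$G_{\langle k,i\rangle}(\boldsymbol s)=\frac au s_{\langle k-1,i\rangle}^u+\frac bu s_{\langle k,i\rangle}^u+\frac cu s_{\langle k+1,i\rangle}^u+\frac{y}{u x^k}s_{\langle k,3-i\rangle}^u+1-\frac{a+b+c+yx^{-k}}{u}.$$ Suppose $b+2\sqrt{ac}<1$ and $$\mu:=\left(1-b-\sqrt{(1-b)^2-4ac}\right)/(2a)>1 .$$ Let $A_i=\{\langle k,i\rangle:k\ge0\}$ for $i=1,2$. Then: (i) if $x=1$ and $b+y+2\sqrt{ac}\le1$, then $\boldsymbol q=\boldsymbol q(A_1)=\boldsymbol q(A_2)<\tilde{\boldsymbol q}=\boldsymbol 1$; (ii) if $x=1$ and $b+y+2\sqrt{ac}>1$, then $\boldsymbol q=\boldsymbol q(A_1)=\boldsymbol q(A_2)=\tilde{\boldsymbol q}<\boldsymbol 1$; (iii) if $x>1$, then $\boldsymbol q<\tilde{\boldsymbol q}$; (iv) if $x>\mu$, then $\boldsymbol q<\boldsymbol q(A_1)<\tilde{\boldsymbol q}$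 and $\boldsymbol q<\boldsymbol q(A_2)<\tilde{\boldsymbol q}$.
   Context: A multitype Galton–Watson process $\{\boldsymbol Z_n\}_{n\ge0}$ with countable type set $\mathcal{X}$, $\boldsymbol Z_n=(Z_{n,j})_{j\in\mathcal{X}}$ (number of type-$j$ individuals in generation $n$), starts from one individual of type $\varphi_0$; each individual lives one generation and, independently of all others, an individual of type $j$ produces offspring vector $\boldsymbol r$ with probability $p_j(\boldsymbol r)$. Its progeny generating vector is $G_j(\boldsymbol s)=\sum_{\boldsymbol r}p_j(\boldsymbol r)\prod_ls_l^{r_l}$, $\boldsymbol s\in[0,1]^{\mathcal{X}}$. With $\mathbb P_i=\mathbb P(\cdot\mid\varphi_0=i)$, for $A\subseteq\mathcal{X}$ set $q_i(A)=\mathbb P_i(\exists n:\sum_{m\ge n}\sum_{j\in A}Z_{m,j}=0)$; $\boldsymbol q=\boldsymbol q(\mathcal{X})$ is the global extinction probability vector, and $\tilde q_i=\mathbb P_i(\lim_nZ_{n,j}=0\ \forall j\in\mathcal{X})$ defines the partial extinction probability vector $\tilde{\boldsymbol q}$. $\boldsymbol 1$ is the all-ones vector. For vectors, $\boldsymbol x<\boldsymbol y$ means $x_i\le y_i$ for all $i$ with strict inequality for at least one $i$. *)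

(* Defs.v *)
From HB Require Import structures.
From mathcomp Require Import all_boot all_order all_algebra.
From mathcomp Require Import finmap multiset.
From mathcomp Require Import all_classical all_reals all_analysis.
Set Implicit Arguments.
Unset Strict Implicit.
Unset Printing Implicit Defensive.
Import Order.TTheory GRing.Theory Num.Theory numFieldNormedType.Exports.
Local Open Scope classical_set_scope.
Local Open Scope ring_scope.

(* A population, or the offspring of one individual, is a multiset of types:
   [r : {mset X}] is a finitely supported vector of nonnegative integers, with
   [r l] its entry of type [l]. *)

Definition offspring_distribution (R : realType) (X : countType)
    (p : X -> {mset X}%mset -> R) : Prop :=
  (forall j r, 0 <= p j r) /\
  forall j, \esum_(r in [set: {mset X}%mset]) (p j r)%:E = 1%E.

Definition progeny_gf (R : realType) (X : countType)
    (p : X -> {mset X}%mset -> R) (j : X) (s : X -> R) : \bar R :=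
  \esum_(r in [set: {mset X}%mset]) (p j r * \prod_(l <- finsupp r) s l ^+ r l)%:E.

(* [P i] is the law given that the initial individual has type [i].
   [offspring (n, j, k)] is the offspring vector of the [k]-th individual of
   type [j] in generation [n]; it is defined whether or not that individual
   is ever born.  Offspring vectors form a countable set, taken with the
   discrete sigma-algebra. *)
Record branching_process (R : realType) (X : countType)
    (p : X -> {mset X}%mset -> R) (d : measure_display) (Omega : measurableType d)
    (P : X -> probability Omega R) := BranchingProcess {
  initial_type : Omega -> X ;
  offspring : nat * X * nat -> Omega -> {mset X}%mset ;
  measurable_initial_type :
    forall B : set X, measurable (initial_type @^-1` B) ;
  initial_typeE : forall i, P i (initial_type @^-1` [set i]) = 1%E ;
  measurable_offspring :
    forall t (B : set {mset X}%mset), measurable (offspring t @^-1` B) ;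
  offspring_law : forall i n j k r,
    P i (offspring (n, j, k) @^-1` [set r]) = (p j r)%:E ;
  offspring_independent :
    forall i (F : {fset nat * X * nat}) (B : nat * X * nat -> set {mset X}%mset),
      P i (\bigcap_(t in [set` F]) offspring t @^-1` B t) =
      (\prod_(t <- F) P i (offspring t @^-1` B t))%E
}.

Section BranchingProcess.
Context {R : realType} {X : countType} {p : X -> {mset X}%mset -> R}.
Context {d : measure_display} {Omega : measurableType d}.
Context {P : X -> probability Omega R} (W : branching_process p P).

(* [generation n w j] is Z_{n,j}. *)
Fixpoint generation (n : nat) (w : Omega) : {mset X}%mset :=
  if n is m.+1 then
    \big[msetD/mset0]_(j <- finsupp (generation m w))
      \big[msetD/mset0]_(k < generation m w j) offspring W (m, j, k : nat) w
  else [mset initial_type W w]%mset.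

Definition extinction_event (A : set X) : set Omega :=
  [set w | exists n : nat,
     (\sum_(n <= m <oo) \esum_(j in A) ((generation m w j)%:R : R)%:E = 0)%E].

Definition partial_extinction_event : set Omega :=
  [set w | forall j, ((generation n w j)%:R : R) @[n --> \oo] --> (0 : R)].

Definition extinction_probability (A : set X) : X -> R :=
  fun i => fine (P i (extinction_event A)).

Definition global_extinction_probability : X -> R :=
  extinction_probability [set: X].

Definition partial_extinction_probability : X -> R :=
  fun i => fine (P i partial_extinction_event).

End BranchingProcess.

Definition vec_lt (R : realType) (X : Type) (v w : X -> R) : Prop :=
  (forall i, v i <= w i) /\ exists i, v i < w i.

(* The type <k,i> is the pair [(k, e)], with [e = false] for i = 1 and
   [e = true] for i = 2, so that 3 - i becomes [~~ e]. *)
Definition X2 : countType := (nat * bool)%type.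

Definition type_line (e : bool) : set X2 := [set t | t.2 = e].

Definition strip_u (R : realType) (a b c y : R) : nat :=
  `|Num.ceil (a + b + c + y + 1)|%N.

Definition strip_gf (R : realType) (a b c x y : R) (t : X2) (s : X2 -> R) : R :=
  let u := strip_u a b c y in
  match t with
  | (0, e) =>
      b / u%:R * s (0%N, e) ^+ u + c / u%:R * s (1%N, e) ^+ u +
      y / u%:R * s (0%N, ~~ e) ^+ u + 1 - (b + c + y) / u%:R
  | (k'.+1 as k, e) =>
      a / u%:R * s (k', e) ^+ u + b / u%:R * s (k, e) ^+ u +
      c / u%:R * s (k.+1, e) ^+ u + y / (u%:R * x ^+ k) * s (k, ~~ e) ^+ u +
      1 - (a + b + c + y * x ^- k) / u%:R
  end.

(* Main.v *)
(* Everything is read off the progeny generating function G.  Writing s^Z for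
   prod_l s_l^(Z_l), the branching property gives E[s^(Z_(n+1)); U] = E[G(s)^(Z_n); U]
   for U determined by the past, so a vector s with G(s) <= s and s = 1 off A bounds
   the probability that A dies out from above, and a vector s with s <= G(s) off A and
   s = 0 on A bounds the probability of never visiting A from below.  By Bernoulli's
   inequality, s = 1 - v is of one of these kinds as soon as v is a suitable sub- or
   supersolution of the mean matrix M:
   - v_k = 1 - (a/c)^(k+1) on one line satisfies M v >= (a+b+c) v with a+b+c > 1, so
     that each line survives by itself with probability bounded below;
   - v_k = g^(k-K) with g = sqrt(a/c) on both lines is a supersolution above level K
     when x > 1, so that from a high level the process rarely returns to level 0;
   - v_k = g^(k-K) with 1/x <= g < 1/mu on one line, and 1 on the other, shows that the
     other line is rarely visited when x > mu;
   - for x = 1, sqrt(a/c)^k is a supersolution when b+y+2 sqrt(ac) <= 1, whereas a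
     parabola times sqrt(a/c)^k on a long window is a strict subsolution otherwise.
   Two recurrence arguments of Borel-Cantelli type complete the proof: a type that is
   visited infinitely often makes its possible offspring types appear infinitely often,
   and a set that is hit with probability bounded below from every type is visited
   infinitely often on survival. *)
Require Import Defs.
From HB Require Import structures.
From mathcomp Require Import all_boot all_order all_algebra.
From mathcomp Require Import finmap multiset.
From mathcomp Require Import all_classical all_reals all_analysis.
From mathcomp Require Import measurable_realfun ring lra.
Set Implicit Arguments.
Unset Strict Implicit.
Unset Printing Implicit Defensive.
Import Order.TTheory GRing.Theory Num.Theory numFieldNormedType.Exports.
Local Open Scope classical_set_scope.
Local Open Scope ring_scope.

(** * Random variables with countably many values *)

Section Discrete.
Local Open Scope ereal_scope.
Context d (T : measurableType d) (R : realType).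

(** Transport along [choice.pickle] turns the unordered sum into a series, to which limit and
    integration theorems apply; codes that decode to nothing contribute 0. *)
Lemma esum_countType (V : countType) (a : V -> \bar R) :
  (forall z, 0 <= a z) ->
  \esum_(z in [set: V]) a z = \sum_(k <oo) oapp a 0 (choice.pickle_inv k).
Proof.
move=> a0; have b0 k : 0 <= oapp a 0 (@choice.pickle_inv V k).
  by case: choice.pickle_inv => /=.
rewrite nneseries_esumT//.
transitivity (\esum_(k in range (@choice.pickle V)) oapp a 0 (choice.pickle_inv k)).
  rewrite (@reindex_esum _ _ _ [set: V] _ (@choice.pickle V)).
    by apply: eq_esum => z _; rewrite choice.pickleK_inv.
  by apply: inj_bij => z z' _ _; exact: (pcan_inj choice.pickleK).
rewrite esum_mkcond; apply: eq_esum => k _; case: ifPn => // kV.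
case E: (@choice.pickle_inv V k) => [z|//]; case/negP: kV.
by rewrite inE; exists z => //; have := @choice.pickle_invK V k; rewrite E.
Qed.

Lemma esumZl (V : countType) (r : R) (a : V -> \bar R) :
  (forall z, 0 <= a z) -> (0 <= r)%R ->
  \esum_(z in [set: V]) (r%:E * a z) = r%:E * \esum_(z in [set: V]) a z.
Proof.
move=> a0 r0; rewrite !esum_countType// -?nneseriesZl.
- by apply: eq_eseriesr => k _; case: choice.pickle_inv => //=; rewrite mule0.
- by move=> k _; case: choice.pickle_inv => /=.
- by move=> z; rewrite mule_ge0.
Qed.

Definition discrete (V : Type) (v : T -> V) :=
  forall B : set V, measurable (v @^-1` B).

Lemma discrete_cst V (z : V) : discrete (cst z).
Proof. by move=> B; rewrite preimage_cst; case: ifP. Qed.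

Lemma eq_discrete (V : Type) (v v' : T -> V) : v =1 v' -> discrete v -> discrete v'.
Proof. by move=> /funext ->. Qed.

(** Split over the countably many values of [v]. This covers the next generation, a sum whose set of
    summands is itself random. *)
Lemma discrete_bind (U V : countType) (v : T -> U) (u : U -> T -> V) :
  discrete v -> (forall z, discrete (u z)) -> discrete (fun w => u (v w) w).
Proof.
move=> dv du B.
rewrite (_ : _ @^-1` _ = \bigcup_z (v @^-1` [set z] `&` u z @^-1` B)).
  apply: countable_bigcupT_measurable => // z.
  by apply: measurableI; [exact: dv|exact: du].
by apply/seteqP; split => [w Bw|w [z _ [/= -> //]]]; exists (v w).
Qed.

Lemma discrete_comp (U V : Type) (v : T -> U) (f : U -> V) :
  discrete v -> discrete (f \o v).
Proof. by move=> dv B; exact: (dv (f @^-1` B)). Qed.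

Lemma discrete_measurable_fun d' (V : Type) (S : measurableType d') (v : T -> V)
    (f : V -> S) (D : set T) :
  discrete v -> measurable D -> measurable_fun D (f \o v).
Proof. by move=> dv mD _ B mB; apply: measurableI => //; exact: (dv (f @^-1` B)). Qed.

Lemma integral_esum_fibers (mu : {measure set T -> \bar R}) (V : countType)
    (v : T -> V) (D : set T) (f : T -> \bar R) :
  discrete v -> measurable D -> measurable_fun setT f -> (forall w, 0 <= f w) ->
  \int[mu]_(w in D) f w =
  \esum_(z in [set: V]) \int[mu]_(w in D `&` v @^-1` [set z]) f w.
Proof.
move=> dv mD mf f0.
pose F k := D `&` v @^-1` [set z | Some z = choice.pickle_inv k].
have FE : \bigcup_k F k = D.
  apply/seteqP; split => [w [k _ []//]|w Dw].
  by exists (choice.pickle (v w)) => //; split=> //=; rewrite choice.pickleK_inv.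
have mF k : measurable (F k) by apply: measurableI => //; exact: dv.
rewrite -[in LHS]FE ge0_integral_bigcup//.
- rewrite esum_countType; last by move=> z; exact: integral_ge0.
  apply: eq_eseriesr => k _; rewrite /F; case: choice.pickle_inv => [z|] /=.
    by congr integral; apply/seteqP; split => w [Dw] /=; [case=> ->|move=> ->].
  by rewrite (_ : _ `&` _ = set0) ?integral_set0//; apply/seteqP; split=> w [].
- exact: measurable_funTS.
- move=> k l _ _ [w [[_ /= wk] [_ /= wl]]].
  have := @choice.pickle_invK V k; have := @choice.pickle_invK V l.
  by rewrite -wk -wl /= => -> ->.
Qed.

End Discrete.

(** * Monomials indexed by multisets *)

Section Monomial.
Context {R : realType} {X : choiceType}.
Implicit Types (s : X -> R) (z : {mset X}%mset).

Definition mset_monomial s z : R := \prod_(l <- finsupp z) s l ^+ z l.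

Lemma mset_monomialE s z (F : {fset X}) : (finsupp z `<=` F)%fset ->
  mset_monomial s z = \prod_(l <- F) s l ^+ z l.
Proof.
move=> zF; apply: big_fset_incl => // l _.
by rewrite memNfinsupp => /eqP ->; rewrite expr0.
Qed.

Lemma mset_monomial0 s : mset_monomial s mset0 = 1.
Proof. by rewrite /mset_monomial big1// => l _; rewrite mset0E expr0. Qed.

Lemma mset_monomial1 s l : mset_monomial s [mset l]%mset = s l.
Proof. by rewrite /mset_monomial finsupp_msetn big_seq_fset1 msetnxx expr1. Qed.

Lemma mset_monomialD s z1 z2 :
  mset_monomial s (z1 `+` z2)%mset = mset_monomial s z1 * mset_monomial s z2.
Proof.
have sub1 : (finsupp z1 `<=` finsupp (z1 `+` z2)%mset)%fset.
  by apply/fsubsetP => l; rewrite !msuppE => lz; rewrite in_msetD lz.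
have sub2 : (finsupp z2 `<=` finsupp (z1 `+` z2)%mset)%fset.
  by apply/fsubsetP => l; rewrite !msuppE => lz; rewrite in_msetD lz orbT.
rewrite (mset_monomialE s sub1) (mset_monomialE s sub2) -big_split /=.
by apply: eq_bigr => l _; rewrite msetE2 exprD.
Qed.

Lemma mset_monomial_sum s (I : Type) (r : seq I) (F : I -> {mset X}%mset) :
  mset_monomial s (\big[msetD/mset0]_(i <- r) F i) =
  \prod_(i <- r) mset_monomial s (F i).
Proof.
by apply: (big_morph (mset_monomial s) (mset_monomialD s)); exact: mset_monomial0.
Qed.

Lemma mset_monomial_itv s z : (forall l, 0 <= s l <= 1) ->
  0 <= mset_monomial s z <= 1.
Proof.
move=> s01; rewrite prodr_ge0 ?prodr_ile1//.
  by move=> l _; case/andP: (s01 l) => s0 s1; rewrite exprn_ge0// exprn_ile1.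
by move=> l _; case/andP: (s01 l) => s0 s1; rewrite exprn_ge0.
Qed.

Lemma le_mset_monomial s s' z : (forall l, 0 <= s l) ->
  (forall l, l \in z -> s l <= s' l) -> mset_monomial s z <= mset_monomial s' z.
Proof.
move=> s0 ss'; rewrite /mset_monomial !big_seq.
apply: ler_prod => l; rewrite msuppE => lz.
by rewrite exprn_ge0//= lerXn2r ?nnegrE ?ss' ?(le_trans (s0 l)) ?ss'.
Qed.

Lemma mset_monomial_le_coord s z l : (forall l, 0 <= s l <= 1) -> l \in z ->
  mset_monomial s z <= s l.
Proof.
move=> s01 lz; rewrite /mset_monomial (big_fsetD1 l) ?msuppE//=.
have [s0 s1] := andP (s01 l).
apply: (@le_trans _ _ (s l ^+ z l)); last first.
  by rewrite ler_iXnr// -in_mset.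
rewrite ler_piMr ?exprn_ge0// prodr_ile1// => k _.
by have [k0 k1] := andP (s01 k); rewrite exprn_ge0//= exprn_ile1.
Qed.

(** A vector that is 0 on [B] and 1 elsewhere turns avoidance probabilities into expectations of
    monomials. *)
Lemma mset_monomial_indic (B : set X) z :
  mset_monomial (\1_(~` B)) z = (`[< forall j, B j -> z j = 0%N >])%:R.
Proof.
case: asboolP => [zB|].
  rewrite /mset_monomial big_seq big1// => l; rewrite msuppE in_mset => lz.
  rewrite indicE mem_set ?expr1n// => /zB z0; by rewrite z0 in lz.
move=> /existsNP[j /not_implyP[Bj /eqP zj]]; apply/eqP.
rewrite eq_le; apply/andP; split; last first.
  by rewrite prodr_ge0// => l _; rewrite exprn_ge0.
apply: (le_trans (mset_monomial_le_coord (l := j) _ _)).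
- by move=> l; rewrite indicE; case: (_ \in _); rewrite ?lexx ?ler01.
- by rewrite -mset_neq0.
- by rewrite indicE memNset//= => /(_ Bj).
Qed.

End Monomial.

(** The generating function [G] as a real vector; for [s] in [0,1] the value is at most 1 and [fine]
    loses nothing ([mean_monomialK]). *)
Definition mean_monomial (R : realType) (X : countType)
    (p : X -> {mset X}%mset -> R) (s : X -> R) (j : X) : R :=
  fine (progeny_gf p j s).

HB.instance Definition _ (X : choiceType) :=
  Monoid.isLaw.Build {mset X}%mset mset0 (@msetD X)
    (@msetDA X) (@mset0D X) (@msetD0 X).

#[local] Arguments generation : simpl never.

(** * Generations as sums over labelled individuals; independence of offspring *)

Section Process.
Local Open Scope ereal_scope.
Context {R : realType} {X : countType} {p : X -> {mset X}%mset -> R}.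
Context {d : measure_display} {Omega : measurableType d}.
Context {P : X -> probability Omega R} (W : branching_process p P).
Local Notation G := (mean_monomial p).
Local Notation Z := (generation W).
Local Notation individual := (nat * X * nat)%type.

(** Labels of the members of generation [n] when its composition is [z]; a single list replaces the
    double sum in [generation]. *)
Definition individuals (n : nat) (z : {mset X}%mset) : seq individual :=
  [seq (n, j, k) | j <- finsupp z, k <- iota 0 (z j)].

Lemma individuals_uniq n z : uniq (individuals n z).
Proof.
apply: allpairs_uniq_dep; [exact: fset_uniq|by move=> j _; exact: iota_uniq|].
by move=> [j k] [j' k'] _ _ /= [-> ->].
Qed.

Lemma individuals_generation n z t : t \in individuals n z -> t.1.1 = n.
Proof. by case/allpairsPdep => j [k [_ _ ->]]. Qed.

Lemma prod_individuals n z (s : X -> R) :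
  (\prod_(t <- individuals n z) s t.1.2 = mset_monomial s z)%R.
Proof.
rewrite big_allpairs_dep; apply: eq_bigr => j _ /=.
by rewrite big_const_seq count_predT size_iota iter_mulr_1.
Qed.

Lemma generationS n w :
  Z n.+1 w = \big[msetD/mset0]_(t <- individuals n (Z n w)) offspring W t w.
Proof.
rewrite /generation -/generation big_allpairs_dep; apply: eq_bigr => j _.
by rewrite -[in RHS](subn0 (Z n w j)) -/(index_iota 0 _) big_mkord.
Qed.

Lemma discrete_total (r : seq individual) :
  discrete (fun w => \big[msetD/mset0]_(t <- r) offspring W t w).
Proof.
elim: r => [|t r IHr].
  by apply: eq_discrete (discrete_cst _ mset0) => w; rewrite big_nil.
pose u z w := (z `+` \big[msetD/mset0]_(j <- r) offspring W j w)%mset.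
apply: (@eq_discrete _ _ _ (fun w => u (offspring W t w) w)).
  by move=> w; rewrite big_cons.
apply: (discrete_bind (u := u)); first exact: (measurable_offspring W t).
by move=> z; exact: (discrete_comp (fun z' => z `+` z')%mset IHr).
Qed.

Lemma discrete_generation n : discrete (Z n).
Proof.
elim: n => [|n IHn].
  exact: (discrete_comp (fun j => [mset j]%mset) (measurable_initial_type W)).
pose u z w := \big[msetD/mset0]_(t <- individuals n z) offspring W t w.
apply: (@eq_discrete _ _ _ (fun w => u (Z n w) w)).
  by move=> w; rewrite -/(Z n.+1 w) generationS.
by apply: (discrete_bind (u := u)) => // z; exact: discrete_total.
Qed.

Section InitialType.
Variable i : X.
Local Notation mu := (P i).

(** Independence of [U] from the offspring vectors labelled in [D], tested on finite families; the
    product also records that these vectors remain mutually independent on [U]. *)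
Definition indep_offspring (D : set individual) (U : set Omega) :=
  measurable U /\
  forall (F : {fset individual}) (B : individual -> set {mset X}%mset),
    [set` F] `<=` D ->
    mu (U `&` \bigcap_(t in [set` F]) offspring W t @^-1` B t) =
    mu U * \prod_(t <- F) mu (offspring W t @^-1` B t).

Lemma indep_offspring_sub D D' U :
  D' `<=` D -> indep_offspring D U -> indep_offspring D' U.
Proof.
by move=> DD [mU iU]; split=> // F B FD; apply: iU => t /FD /DD.
Qed.

(** Conditioning on one offspring vector uses up its label, which leaves [D]. *)
Lemma indep_offspringI D U t B : D t -> indep_offspring D U ->
  mu (U `&` offspring W t @^-1` B) = mu U * mu (offspring W t @^-1` B) /\
  indep_offspring (D `\ t) (U `&` offspring W t @^-1` B).
Proof.
move=> Dt [mU iU].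
have E : mu (U `&` offspring W t @^-1` B) = mu U * mu (offspring W t @^-1` B).
  have := iU [fset t]%fset (fun=> B); rewrite big_seq_fset1 set_fset1 bigcap_set1.
  by apply; move=> _ ->.
split=> //; split=> [|F B' FD].
  by apply: measurableI => //; exact: measurable_offspring.
have tF : t \notin F by apply/negP => /FD[_]; exact.
rewrite E -muleA.
pose B2 t' := if t' == t then B else B' t'.
have B2t : B2 t = B by rewrite /B2 eqxx.
have B2F t' : t' \in F -> B2 t' = B' t'.
  by rewrite /B2; case: eqP => // -> tF'; rewrite tF' in tF.
have := iU (t |` F)%fset B2; rewrite big_fsetU1//= B2t => iUF.
rewrite -[X in mu U * (_ * X)](_ : \prod_(j <- F) mu (offspring W j @^-1` B2 j) = _).
  rewrite -iUF; last first.
    by move=> t'; rewrite /= in_fset1U => /orP[/eqP ->//|/FD[]].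
  congr (mu _); rewrite -setIA; congr (_ `&` _).
  apply/seteqP; split => [w [tw Fw] t' /=|w Fw].
    rewrite in_fset1U => /orP[/eqP ->|t'F]; first by rewrite B2t.
    by rewrite B2F//; exact: Fw.
  split; first by have := Fw t; rewrite /= in_fset1U eqxx B2t; exact.
  move=> t' t'F; have := Fw t'; rewrite /= in_fset1U t'F orbT B2F//; exact.
by rewrite !big_seq; apply: eq_bigr => t' t'F; rewrite B2F.
Qed.

Lemma measure_indep_offspringI D U t r : D t -> indep_offspring D U ->
  mu (U `&` offspring W t @^-1` [set r]) = mu U * (p t.1.2 r)%:E.
Proof.
move=> Dt iU; rewrite (indep_offspringI [set r] Dt iU).1.
by case: t Dt => [[n j] k] Dt; rewrite offspring_law.
Qed.

End InitialType.
End Process.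

(** * The branching property *)

Section OneStep.
Local Open Scope ereal_scope.
Context {R : realType} {X : countType} {p : X -> {mset X}%mset -> R}.
Context {d : measure_display} {Omega : measurableType d}.
Context {P : X -> probability Omega R} (W : branching_process p P).
Local Notation G := (mean_monomial p).
Local Notation Z := (generation W).
Local Notation individual := (nat * X * nat)%type.
Variable i : X.
Local Notation mu := (P i).

Lemma measure_esum_fibers (V : countType) (v : Omega -> V) (U : set Omega) :
  discrete v -> measurable U ->
  mu U = \esum_(z in [set: V]) mu (U `&` v @^-1` [set z]).
Proof.
move=> dv mU; rewrite -[LHS]mul1e -(integral_cst mu mU).
rewrite (integral_esum_fibers mu dv mU)//.
apply: eq_esum => z _; rewrite integral_cst ?mul1e//.
by apply: measurableI => //; exact: dv.
Qed.

Lemma fine_probabilityK (U : set Omega) : measurable U -> (fine (mu U))%:E = mu U.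
Proof. by move=> mU; rewrite fineK// fin_num_measure. Qed.

(** Both sides are countably additive over the fibers of [v]. *)
Lemma indep_offspring_fibers (V : countType) (v : Omega -> V) D U :
  discrete v -> measurable U ->
  (forall z, indep_offspring W i D (U `&` v @^-1` [set z])) ->
  indep_offspring W i D U.
Proof.
move=> dv mU iv; split=> // F B FD.
have mO t : measurable (offspring W t @^-1` B t) by exact: measurable_offspring.
rewrite (measure_esum_fibers dv mU) (measure_esum_fibers dv); last first.
  apply: measurableI => //; apply: fin_bigcap_measurable => // t _; exact: mO.
pose c := (\prod_(t <- F) fine (mu (offspring W t @^-1` B t)))%R.
have -> : \prod_(t <- F) mu (offspring W t @^-1` B t) = c%:E.
  by rewrite -prodEFin; apply: eq_bigr => t _; rewrite fine_probabilityK.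
have c0 : (0 <= c)%R by apply: prodr_ge0 => t _; exact: fine_ge0.
rewrite muleC -esumZl//; apply: eq_esum => z _; rewrite muleC.
rewrite setIAC (iv z).2//; congr (_ * _).
by rewrite -prodEFin; apply: eq_bigr => t _; rewrite fine_probabilityK.
Qed.

(** Induction on [ts]: fixing the first offspring vector uses up its label and turns the constraint
    [B] on the total into one on the total of the rest. *)
Lemma indep_offspring_total ts D D' U (B : set {mset X}%mset) :
  uniq ts -> (forall t, t \in ts -> D t) -> D' `<=` D `\` [set` ts] ->
  indep_offspring W i D U ->
  indep_offspring W i D'
    (U `&` (fun w => \big[msetD/mset0]_(t <- ts) offspring W t w) @^-1` B).
Proof.
elim: ts U D B => [|t ts IHts] U D B.
  move=> _ _ D'D iU; have [mU _] := iU.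
  have /(indep_offspring_sub (W := W) (i := i)) iU' : D' `<=` D by move=> t /D'D[].
  have [B0|B0] := pselect (B mset0).
    rewrite (_ : _ `&` _ = U); first exact: iU'.
    by apply/seteqP; split => [w []//|w Uw]; split=> //=; rewrite big_nil.
  rewrite (_ : _ `&` _ = set0); last first.
    by apply/seteqP; split => [w []|w]//=; rewrite big_nil.
  by split=> // F C _; rewrite set0I measure0 mul0e.
move=> /= /andP[tts uts] Dts D'D iU; have [mU _] := iU.
have Dt : D t by apply: Dts; rewrite mem_head.
pose u r w := \big[msetD/mset0]_(t <- r) offspring W t w.
apply: (indep_offspring_fibers (v := offspring W t)).
- exact: (measurable_offspring W t).
- by apply: measurableI => //; exact: discrete_total.
move=> r; rewrite [X in indep_offspring _ _ _ X](_ : _ = U `&` offspring W t @^-1` [set r] `&`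
    u ts @^-1` [set z | B (r `+` z)%mset]); last first.
  apply/seteqP; split => w /=.
    by move=> [[Uw]]; rewrite big_cons => Bw tr; rewrite -tr.
  by move=> [[Uw <-] Bw]; rewrite big_cons.
apply: (IHts _ (D `\ t)) => //.
- move=> t' t'ts; split; first by apply: Dts; rewrite inE t'ts orbT.
  by move=> /= E; rewrite -E t'ts in tts.
- move=> t' /D'D[Dt' /= /negP]; rewrite inE negb_or => /andP[/eqP nt /negP nts].
  by split.
- exact: (indep_offspringI [set r] Dt iU).2.
Qed.

(* Stands for "U is determined by the generations up to n": on each fiber of Z n, the
   event U is independent of the offspring of the generations n and later. *)
Definition past n U :=
  forall z, indep_offspring W i [set t | n <= t.1.1]%N (U `&` Z n @^-1` [set z]).

Lemma past_measurable n U : past n U -> measurable U.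
Proof.
move=> pU; rewrite (_ : U = \bigcup_z (U `&` Z n @^-1` [set z])).
  by apply: countable_bigcupT_measurable; [exact: countableP|move=> z; exact: (pU z).1].
by apply/seteqP; split => [w Uw|w [z _ []//]]; exists (Z n w).
Qed.

(** The initial type is almost surely [i], so each fiber of generation 0 has probability 0 or 1 and
    is independent of every event. *)
Lemma past0 : past 0 setT.
Proof.
move=> z; rewrite setTI; set E := _ @^-1` _.
have mE : measurable E by exact: (discrete_generation W 0).
split=> // F B _; set C := \bigcap_(t in _) _.
have mC : measurable C.
  by apply: fin_bigcap_measurable => // t _; exact: measurable_offspring.
have := offspring_independent W i F B; rewrite -/C => <-.
have mi := measurable_initial_type W [set i].
have i0 : mu (~` (initial_type W @^-1` [set i])) = 0.
  by rewrite probability_setC// initial_typeE subee.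
have [zi|zi] := eqVneq z [mset i]%mset.
  have E0 : mu (~` E) = 0.
    apply: (subset_measure0 _ _ _ i0); [exact: measurableC..|].
    by apply: subsetC => w /= E1; rewrite /E /generation /= E1 zi.
  have -> : mu E = 1 by rewrite -[E]setCK probability_setC ?E0 ?sube0//; exact: measurableC.
  rewrite mul1e [RHS](measureDI mu mC mE) setIC.
  rewrite (@subset_measure0 _ _ _ mu (C `\` E) (~` E)) ?add0e//.
  - exact: measurableD.
  - exact: measurableC.
have E0 : mu E = 0.
  apply: (subset_measure0 _ _ _ i0) => //; first exact: measurableC.
  by move=> w Ew /= E1; move: Ew zi; rewrite /E /generation /= E1 => ->; rewrite eqxx.
rewrite E0 mul0e; apply: (subset_measure0 _ _ _ E0) => //.
exact: measurableI.
Qed.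

(** On a fiber of [Z n], the next generation is a sum over labels of generation [n], and those
    labels are dropped when [n] becomes [n.+1]. *)
Lemma pastS n U : past n U -> past n.+1 U.
Proof.
move=> pU z.
apply: (indep_offspring_fibers (discrete_generation W n)).
  apply: measurableI; first exact: past_measurable pU.
  exact: discrete_generation.
move=> z'; rewrite [X in indep_offspring _ _ _ X](_ : _ = U `&` Z n @^-1` [set z'] `&`
  (fun w => \big[msetD/mset0]_(t <- individuals n z') offspring W t w) @^-1` [set z]).
  apply: (indep_offspring_total _ _ _ _ (pU z')).
  - exact: individuals_uniq.
  - by move=> t /individuals_generation /= ->.
  - move=> t /= nt; split; first exact: ltnW.
    by move=> /= /individuals_generation E; rewrite E ltnn in nt.
by apply/seteqP; split => w /= [[Uw]]; rewrite generationS => E <-; split=> //; split=> //; rewrite ?E.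
Qed.

Lemma pastI n U S : past n U -> past n (U `&` Z n @^-1` S).
Proof.
move=> pU z; have [Sz|Sz] := pselect (S z).
  rewrite [X in indep_offspring _ _ _ X](_ : _ = U `&` Z n @^-1` [set z]); first exact: pU.
  by apply/seteqP; split => w /=; [move=> [[]]|move=> [? E]; rewrite E].
rewrite [X in indep_offspring _ _ _ X](_ : _ = set0).
  by split=> // F C _; rewrite set0I measure0 mul0e.
by apply/seteqP; split => w //= [[_ Sw] E]; apply: Sz; rewrite -E.
Qed.

Section Monomials.
Variable s : X -> R.
Hypothesis s01 : forall l, (0 <= s l <= 1)%R.

Lemma monomial_ge0 z : (0 <= mset_monomial s z)%R.
Proof. by case/andP: (mset_monomial_itv z s01). Qed.

Lemma measurable_monomial (v : Omega -> {mset X}%mset) (D : set Omega) :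
  discrete v -> measurable D ->
  measurable_fun D (fun w => (mset_monomial s (v w))%:E).
Proof.
by move=> dv mD; exact: (discrete_measurable_fun (fun z => (mset_monomial s z)%:E) dv mD).
Qed.

Lemma integral_offspring t :
  \int[mu]_w (mset_monomial s (offspring W t w))%:E = progeny_gf p t.1.2 s.
Proof.
have dt := measurable_offspring W t.
rewrite (integral_esum_fibers mu dt)//; last 2 first.
  exact: measurable_monomial.
  by move=> w; rewrite lee_fin monomial_ge0.
apply: eq_esum => r _; rewrite setTI.
set A := _ @^-1` _; have mA : measurable A by exact: dt.
rewrite (@eq_integral _ _ _ _ _ (cst (mset_monomial s r)%:E)); last first.
  by move=> w /[!inE] /= ->.
rewrite integral_cst// muleC.
rewrite EFinM; congr (_ * _).
by case: t @A {mA dt} => [[n j] k] A; exact: offspring_law.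
Qed.

Lemma progeny_gf_itv j : 0 <= progeny_gf p j s <= 1.
Proof.
have dt := measurable_offspring W (0%N, j, 0%N).
rewrite -[j]/((0%N, j, 0%N).1.2) -integral_offspring integral_ge0/=; last first.
  by move=> w _; rewrite lee_fin monomial_ge0.
rewrite -(probability_setT mu) -[leRHS]mul1e -integral_cst//.
apply: ge0_le_integral => //.
- by move=> w _; rewrite lee_fin monomial_ge0.
- exact: measurable_monomial.
- by move=> w _; rewrite lee_fin; case/andP: (mset_monomial_itv (offspring W (0%N, j, 0%N) w) s01).
Qed.

Lemma mean_monomialK j : (G s j)%:E = progeny_gf p j s.
Proof.
have /andP[g0 g1] := progeny_gf_itv j.
by rewrite fineK// ge0_fin_numE// (le_lt_trans g1)// ltry.
Qed.

Lemma mean_monomial_itv j : (0 <= G s j <= 1)%R.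
Proof. by rewrite -!lee_fin mean_monomialK; exact: (progeny_gf_itv j). Qed.

(** Splitting over the value of the first vector factors out its generating function; induction
    treats the others on the smaller event. *)
Lemma integral_prod_offspring ts D U :
  uniq ts -> (forall t, t \in ts -> D t) -> indep_offspring W i D U ->
  \int[mu]_(w in U) (\prod_(t <- ts) mset_monomial s (offspring W t w))%:E =
  mu U * (\prod_(t <- ts) G s t.1.2)%:E.
Proof.
elim: ts U D => [|t ts IHts] U D.
  move=> _ _ [mU _]; rewrite big_nil mule1 -[RHS]mul1e -integral_cst//.
  by apply: eq_integral => w _; rewrite big_nil.
move=> /= /andP[tts uts] Dts iU; have [mU _] := iU.
have Dt : D t by apply: Dts; rewrite mem_head.
have dt := measurable_offspring W t.
have mprod r : discrete (fun w => \prod_(t <- r) mset_monomial s (offspring W t w))%R.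
  move=> B; rewrite (_ : _ @^-1` _ = (fun w => \big[msetD/mset0]_(t <- r) offspring W t w)
    @^-1` (mset_monomial s @^-1` B)); first exact: discrete_total.
  by apply/seteqP; split=> w /=; rewrite mset_monomial_sum.
have mf r D' : measurable D' ->
    measurable_fun D' (fun w => (\prod_(t <- r) mset_monomial s (offspring W t w))%:E).
  by move=> mD; exact: (discrete_measurable_fun EFin (mprod r) mD).
have prod_ge0 r w : (0 <= \prod_(t <- r) mset_monomial s (offspring W t w))%R.
  by apply: prodr_ge0 => t' _; exact: monomial_ge0.
rewrite (integral_esum_fibers mu dt mU); last 2 first.
- exact: (mf (t :: ts)).
- by move=> w; rewrite lee_fin.
pose c := (fine (mu U) * \prod_(t <- ts) G s t.1.2)%R.
have c0 : (0 <= c)%R.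
  apply: mulr_ge0; first exact: fine_ge0.
  by apply: prodr_ge0 => t' _; case/andP: (mean_monomial_itv t'.1.2).
transitivity (\esum_(r in [set: {mset X}%mset])
    (c%:E * (p t.1.2 r * mset_monomial s r)%:E)).
  apply: eq_esum => r _; have [_ iUr] := indep_offspringI [set r] Dt iU.
  have [mUr _] := iUr.
  rewrite (@eq_integral _ _ _ _ _ (fun w => (mset_monomial s r)%:E *
    (\prod_(t <- ts) mset_monomial s (offspring W t w))%:E)); last first.
    by move=> w /[!inE] -[_ /= <-]; rewrite big_cons EFinM.
  rewrite (ge0_integralZl_EFin mu mUr _ (mf ts _ mUr)) ?monomial_ge0//; last first.
    by move=> w _; rewrite lee_fin.
  rewrite (IHts _ (D `\ t))//; last first.
    move=> t' t'ts; split; first by apply: Dts; rewrite inE t'ts orbT.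
    by move=> /= E; rewrite -E t'ts in tts.
  rewrite (measure_indep_offspringI r Dt iU) -(fine_probabilityK mU).
  by rewrite -!EFinM /c; congr EFin; lra.
rewrite esumZl//; last first.
  move=> r; rewrite lee_fin mulr_ge0 ?monomial_ge0//.
  case: t {Dt dt Dts tts} => [[n j] k]; rewrite -lee_fin.
  by rewrite -(offspring_law W i n j k r).
rewrite big_cons -/(progeny_gf p t.1.2 s) -mean_monomialK -(fine_probabilityK mU).
by rewrite -!EFinM /c; congr EFin; lra.
Qed.

(** The branching property: on the fiber [Z n = z] the monomial of the next generation is a product
    over the individuals of [z], which are independent of that fiber. *)
Lemma integral_generationS n U : past n U ->
  \int[mu]_(w in U) (mset_monomial s (Z n.+1 w))%:E =
  \int[mu]_(w in U) (mset_monomial (G s) (Z n w))%:E.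
Proof.
move=> pU; have mU := past_measurable pU.
have dZ := discrete_generation W n.
rewrite (integral_esum_fibers mu dZ mU); last 2 first.
- by apply: measurable_monomial => //; exact: discrete_generation.
- by move=> w; rewrite lee_fin monomial_ge0.
rewrite (integral_esum_fibers mu dZ mU); last 2 first.
- exact: (discrete_measurable_fun (fun z => (mset_monomial (G s) z)%:E) dZ).
- move=> w; rewrite lee_fin; apply: prodr_ge0 => l _.
  by rewrite exprn_ge0//; case/andP: (mean_monomial_itv l).
apply: eq_esum => z _; have [mUz _] := pU z.
rewrite [RHS](@eq_integral _ _ _ _ _ (cst (mset_monomial (G s) z)%:E)); last first.
  by move=> w /[!inE] -[_ /= ->].
rewrite integral_cst// muleC -(prod_individuals n).
rewrite -(integral_prod_offspring _ _ (pU z)).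
- apply: eq_integral => w /[!inE] -[_ zw].
  by rewrite generationS mset_monomial_sum zw.
- exact: individuals_uniq.
- by move=> t /individuals_generation /= ->.
Qed.

End Monomials.
End OneStep.

(** * Monotone limits and null sets of a probability *)

Section MeasureLimits.
Local Open Scope ereal_scope.
Context d (T : measurableType d) (R : realType) (mu : probability T R).

Lemma le_bigcup_nondecreasing (F : (set T)^nat) (c : \bar R) :
  (forall n, measurable (F n)) -> nondecreasing_seq F ->
  (forall n, mu (F n) <= c) -> mu (\bigcup_n F n) <= c.
Proof.
move=> mF ndF Fc; apply: cvge_le (nondecreasing_cvg_mu mF _ ndF).
  exact: nearW.
exact: bigcupT_measurable.
Qed.

(** Continuity from above; the factor [r] is there for comparisons with a multiple of a probability,
    as in [D <= (1 - e) D]. *)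
Lemma ge_bigcap_nonincreasing (F : (set T)^nat) (r : R) (c : \bar R) :
  (forall n, measurable (F n)) -> nonincreasing_seq F ->
  (forall n, c <= r%:E * mu (F n)) -> c <= r%:E * mu (\bigcap_n F n).
Proof.
move=> mF niF cF; have : (fun n => r%:E * mu (F n)) @ \oo --> r%:E * mu (\bigcap_n F n); last first.
  by apply: cvge_ge; exact: nearW.
apply: cvgeZl => //; apply: nonincreasing_cvg_mu => //.
- by rewrite (le_lt_trans (probability_le1 _ _))// ltry.
- exact: bigcapT_measurable.
Qed.

Lemma le_fine_probability (A B : set T) :
  measurable A -> measurable B -> mu.-negligible (A `\` B) ->
  (fine (mu A) <= fine (mu B))%R.
Proof.
move=> mA mB AB; rewrite fine_le ?fin_num_measure//.
have AB0 : mu (A `\` B) = 0 by apply/negligibleP => //; exact: measurableD.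
rewrite (measureDI mu mA mB) [X in X + _]AB0 add0e.
by rewrite le_measure// inE//; exact: measurableI.
Qed.

Lemma negligible_bigcup_countType (V : countType) (F : V -> set T) :
  (forall z, mu.-negligible (F z)) -> mu.-negligible (\bigcup_z F z).
Proof.
move=> nF; pose H n := if @choice.pickle_inv V n is Some z then F z else set0.
apply: (@negligibleS _ _ _ _ (\bigcup_n H n)).
  by move=> w [z _ Fw]; exists (choice.pickle z) => //; rewrite /H choice.pickleK_inv.
apply: negligible_bigcup => n; rewrite /H; case: choice.pickle_inv => [z|] //.
exact: negligible_set0.
Qed.

End MeasureLimits.

(** * Extinction events *)

Section ExtinctionEvents.
Local Open Scope ereal_scope.
Context {R : realType} {X : countType} {p : X -> {mset X}%mset -> R}.
Context {d : measure_display} {Omega : measurableType d}.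
Context {P : X -> probability Omega R} (W : branching_process p P).
Local Notation Z := (generation W).

Definition avoids (B : set X) n : set Omega :=
  [set w | forall j, B j -> Z n w j = 0%N].

Definition avoids_between B n m : set Omega :=
  [set w | forall k, (n <= k <= m)%N -> avoids B k w].

Definition avoids_from B n : set Omega :=
  [set w | forall m, (n <= m)%N -> avoids B m w].

(** A series of nonnegative terms vanishes only if each term does, so the defining condition says
    that [B] is empty in every generation from [n] on. *)
Lemma extinction_eventE B : extinction_event W B = \bigcup_n avoids_from B n.
Proof.
have Zge0 B' m w : 0 <= \esum_(j in B') ((Z m w j)%:R : R)%:E.
  by apply: esum_ge0 => j _; rewrite lee_fin.
apply/seteqP; split => [w [n Zn]|w [n _ Zn]]; exists n => //.
  move=> m nm j Bj; apply/eqP; rewrite -(@pnatr_eq0 R) eq_le ler0n andbT -lee_fin.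
  have /le_trans : ((Z m w j)%:R : R)%:E <= \esum_(j in B) ((Z m w j)%:R : R)%:E.
    rewrite -[leLHS](@esum_set1 _ _ j (fun j => ((Z m w j)%:R : R)%:E)) ?lee_fin//.
    apply: le_ereal_sup => _ [A [finA AB] <-]; exists A => //; split=> // l /AB ->.
    exact: Bj.
  apply; have := @nneseries_lim_ge R (fun m => \esum_(j in B) ((Z m w j)%:R : R)%:E)
    xpredT n m.+1 (fun k _ _ => Zge0 B k w).
  rewrite Zn big_nat_recr//=; apply: le_trans; rewrite leeDr//.
  by apply: sume_ge0 => k _; exact: Zge0.
apply: eseries0 => m nm _; apply: esum1 => j Bj.
by rewrite (Zn _ nm _ Bj).
Qed.

Lemma partial_extinction_eventE :
  partial_extinction_event W = \bigcap_(j in [set: X]) extinction_event W [set j].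
Proof.
apply/seteqP; split => [w Zw j _|w Zw j].
  (* A count at distance less than 1 from 0 is 0. *)
  rewrite extinction_eventE; have /cvgrPdist_lt /(_ 1%R ltr01) [n _ nZ] := Zw j.
  exists n => // m nm _ ->; have := nZ _ nm.
  by rewrite /= sub0r normrN normr_nat (ltr_nat R _ 1) ltnS leqn0 => /eqP.
have := Zw j I; rewrite extinction_eventE => -[n _ nZ].
apply: cvg_near_cst; exists n => // m nm /=.
by rewrite (nZ _ nm).
Qed.

Lemma measurable_avoids B n : measurable (avoids B n).
Proof. exact: (discrete_generation W n [set z | forall j, B j -> z j = 0%N]). Qed.

Lemma avoids_betweenS B n m :
  avoids_between B n (n + m.+1) = avoids B n `&` avoids_between B n.+1 (n.+1 + m).
Proof.
apply/seteqP; split => [w Aw|w [An Aw] k /andP[]].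
  split; first by apply: Aw; rewrite leqnn leq_addr.
  by move=> k /andP[nk km]; apply: Aw; rewrite -addSnnS km (ltnW nk).
rewrite leq_eqVlt => /orP[/eqP <- //|nk km].
by apply: Aw; rewrite nk addSnnS.
Qed.

Lemma avoids_between_recr B n m :
  avoids_between B n (n + m).+1 = avoids_between B n (n + m) `&` avoids B (n + m).+1.
Proof.
apply/seteqP; split => [w Aw|w [Aw Am] k /andP[nk]].
  split; last by apply: Aw; rewrite leqnn leqW// leq_addr.
  by move=> k /andP[nk km]; apply: Aw; rewrite nk leqW.
rewrite leq_eqVlt => /orP[/eqP -> //|km].
by apply: Aw; rewrite nk.
Qed.

Lemma avoids_between_refl B n : avoids_between B n n = avoids B n.
Proof.
apply/seteqP; split => [w|w Aw k]; first by apply; rewrite leqnn.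
by move=> /andP[nk kn]; have -> : k = n by apply/eqP; rewrite eqn_leq kn.
Qed.

Lemma measurable_avoids_between B n m : measurable (avoids_between B n (n + m)).
Proof.
elim: m => [|m IHm]; first by rewrite addn0 avoids_between_refl; exact: measurable_avoids.
rewrite addnS avoids_between_recr; apply: measurableI => //; exact: measurable_avoids.
Qed.

Lemma avoids_fromE B n : avoids_from B n = \bigcap_m avoids_between B n (n + m).
Proof.
apply/seteqP; split => [w Aw m _ k /andP[nk _]|w Aw m nm]; first exact: Aw.
by have := Aw (m - n)%N I; apply; rewrite nm subnKC//=.
Qed.

Lemma nonincreasing_avoids_between B n :
  nonincreasing_seq (fun m => avoids_between B n (n + m)).
Proof.
move=> m m' mm'; apply/subsetPset => w Aw k /andP[nk km]; apply: Aw.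
by rewrite nk (leq_trans km)// leq_add2l.
Qed.

Lemma measurable_avoids_from B n : measurable (avoids_from B n).
Proof.
by rewrite avoids_fromE; apply: bigcapT_measurable => m; exact: measurable_avoids_between.
Qed.

Lemma nondecreasing_avoids_from B : nondecreasing_seq (avoids_from B).
Proof.
by move=> n n' nn'; apply/subsetPset => w Aw m nm; apply: Aw; exact: leq_trans nm.
Qed.

Lemma measurable_extinction_event B : measurable (extinction_event W B).
Proof.
rewrite extinction_eventE.
by apply: bigcupT_measurable => n; exact: measurable_avoids_from.
Qed.

Lemma measurable_partial_extinction_event : measurable (partial_extinction_event W).
Proof.
rewrite partial_extinction_eventE -[X in measurable X]setCK setC_bigcap.
apply: measurableC; apply: countable_bigcupT_measurable; first exact: countableP.
by move=> j; apply: measurableC; exact: measurable_extinction_event.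
Qed.

Lemma sub_extinction_event B B' : B `<=` B' ->
  extinction_event W B' `<=` extinction_event W B.
Proof.
move=> BB' w; rewrite !extinction_eventE => -[n _ Aw]; exists n => // m nm j Bj.
by apply: Aw => //; exact: BB'.
Qed.

Lemma generation_mset0 n m w : (n <= m)%N -> Z n w = mset0 -> Z m w = mset0.
Proof.
move=> /subnKC <- Zn; elim: (m - n)%N => [|k IHk]; first by rewrite addn0.
by rewrite addnS generationS IHk /individuals finsupp0 big_nil.
Qed.

Lemma partial_extinction_event_sub B : finite_set B ->
  partial_extinction_event W `<=` extinction_event W B.
Proof.
move=> finB w; rewrite partial_extinction_eventE => Zw.
have /choice[N NZ] : forall j, exists n, avoids_from [set j] n w.
  by move=> j; have := Zw j I; rewrite extinction_eventE => -[n _ ?]; exists n.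
have [F FB] := finite_fsetP.1 finB; rewrite extinction_eventE.
exists (\max_(j <- F) N j)%N => // m Nm j Bj.
apply: (NZ j) => //; apply: leq_trans Nm.
have jF : j \in F by move: Bj; rewrite FB.
by rewrite (big_fsetD1 j)//= leq_maxl.
Qed.

End ExtinctionEvents.

(** * Extinction criteria *)

Section Criteria.
Local Open Scope ereal_scope.
Context {R : realType} {X : countType} {p : X -> {mset X}%mset -> R}.
Context {d : measure_display} {Omega : measurableType d}.
Context {P : X -> probability Omega R} (W : branching_process p P).
Local Notation Z := (generation W).
Local Notation G := (mean_monomial p).
Implicit Types (s : X -> R) (B : set X).

Lemma indic_itv (B : set X) l : (0 <= (\1_B l : R) <= 1)%R.
Proof. by rewrite indicE; case: (_ \in _); rewrite lexx ler01. Qed.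

Lemma pastT i n : past W i n setT.
Proof. by elim: n => [|n IHn]; [exact: past0|exact: pastS]. Qed.

Lemma past_avoids_between i B n m : past W i (n + m) (avoids_between W B n (n + m)).
Proof.
elim: m => [|m IHm].
  rewrite addn0 avoids_between_refl -[avoids _ _ _]setTI.
  exact: (pastI [set z | forall j, B j -> z j = 0%N] (pastT i n)).
rewrite addnS avoids_between_recr.
exact: (pastI [set z | forall j, B j -> z j = 0%N] (pastS IHm)).
Qed.

Section InitialType.
Variable i : X.
Local Notation mu := (P i).

Lemma integral_generation0 s : (forall l, (0 <= s l <= 1)%R) ->
  \int[mu]_w (mset_monomial s (Z 0 w))%:E = (s i)%:E.
Proof.
move=> s01; have mi := measurable_initial_type W [set i].
have mC : measurable (~` (initial_type W @^-1` [set i])) by exact: measurableC.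
have i0 : mu (~` (initial_type W @^-1` [set i])) = 0.
  by rewrite probability_setC// initial_typeE subee.
rewrite (ge0_negligible_integral mC)//; last 2 first.
- by apply: measurable_monomial => //; exact: discrete_generation.
- by move=> w _; rewrite lee_fin monomial_ge0.
rewrite setTD setCK (@eq_integral _ _ _ _ _ (cst (s i)%:E)); last first.
  by move=> w /[!inE] /= wi; rewrite /generation wi mset_monomial1.
by rewrite integral_cst//= initial_typeE mule1.
Qed.

Lemma integral_avoids U n B : measurable U ->
  \int[mu]_(w in U) (mset_monomial (\1_(~` B)) (Z n w))%:E = mu (U `&` avoids W B n).
Proof.
move=> mU; rewrite setIC -integral_indic//; last exact: measurable_avoids.
by apply: eq_integral => w _; rewrite mset_monomial_indic indicE.
Qed.

Lemma le_integral_monomial s s' U n : measurable U ->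
  (forall l, (0 <= s l <= 1)%R) -> (forall l, (0 <= s' l <= 1)%R) ->
  (forall w l, U w -> l \in Z n w -> (s l <= s' l)%R) ->
  \int[mu]_(w in U) (mset_monomial s (Z n w))%:E <=
  \int[mu]_(w in U) (mset_monomial s' (Z n w))%:E.
Proof.
move=> mU s01 s'01 ss'; have dZ := discrete_generation W n.
apply: ge0_le_integral => //.
- by move=> w _; rewrite lee_fin monomial_ge0.
- exact: measurable_monomial.
- exact: measurable_monomial.
- move=> w Uw; rewrite lee_fin le_mset_monomial// => l; first by case/andP: (s01 l).
  exact: ss'.
Qed.

(** By [G s <= s] the expected monomial at generation [n] stays at most [s i]; it is 1 when [B] is
    absent, because [s] is 1 off [B]. *)
Lemma extinction_le_supersolution B s : (forall l, (0 <= s l <= 1)%R) ->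
  (forall j, ~ B j -> s j = 1%R) -> (forall j, (G s j <= s j)%R) ->
  mu (extinction_event W B) <= (s i)%:E.
Proof.
move=> s01 sB Gs; rewrite extinction_eventE.
have s_le n : \int[mu]_w (mset_monomial s (Z n w))%:E <= (s i)%:E.
  elim: n => [|n]; first by rewrite integral_generation0.
  apply: le_trans; rewrite (integral_generationS s01 (pastT i n)).
  apply: le_integral_monomial => //; exact: (mean_monomial_itv W i s01).
apply: le_bigcup_nondecreasing => [n||n].
- exact: measurable_avoids_from.
- exact: nondecreasing_avoids_from.
apply: le_trans (s_le n).
apply: (@le_trans _ _ (mu (setT `&` avoids W B n))).
  rewrite le_measure ?inE ?setTI//; first exact: measurable_avoids_from.
    exact: measurable_avoids.
  by move=> w; apply.
rewrite -integral_avoids//; apply: le_integral_monomial => //; first exact: indic_itv.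
move=> w l _ _; rewrite indicE; case: (boolP (l \in _)) => [|_]; last by case/andP: (s01 l).
by rewrite inE => /sB ->.
Qed.

(** The expected monomial on the event that [B] has been avoided so far never falls below [s i].
    Restricting to avoidance costs nothing ([cut]), as [s] vanishes on [B]; off [B] the bound
    [s <= G s] applies. *)
Lemma avoids_ge_subsolution B s : (forall l, (0 <= s l <= 1)%R) ->
  (forall j, B j -> s j = 0%R) -> (forall j, ~ B j -> (s j <= G s j)%R) ->
  (s i)%:E <= mu (avoids_from W B 0).
Proof.
move=> s01 sB Gs; rewrite -[leRHS]mul1e avoids_fromE.
have m0 z : (0 <= mset_monomial s z)%R by exact: monomial_ge0.
have cut U n : \int[mu]_(w in U) (mset_monomial s (Z n w))%:E =
    \int[mu]_(w in U `&` avoids W B n) (mset_monomial s (Z n w))%:E.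
  rewrite integral_mkcondr; apply: eq_integral => w _; rewrite patchE.
  case: ifPn => // /negP; rewrite inE => /existsNP[j /not_implyP[Bj Zj]].
  apply: congr1; apply/eqP; rewrite eq_le m0 andbT -(sB j Bj).
  by rewrite mset_monomial_le_coord// -mset_neq0; apply/eqP.
have s_le m : (s i)%:E <=
    \int[mu]_(w in avoids_between W B 0 (0 + m)) (mset_monomial s (Z (0 + m) w))%:E.
  elim: m => [|m IHm].
    by rewrite addn0 avoids_between_refl -[avoids _ _ _]setTI -cut integral_generation0.
  rewrite addnS avoids_between_recr -cut.
  have pA := past_avoids_between i B 0 m.
  rewrite (integral_generationS s01 pA); apply: le_trans IHm _.
  apply: le_integral_monomial => //.
  - exact: past_measurable pA.
  - exact: (mean_monomial_itv W i s01).
  move=> w l Aw; rewrite -mset_neq0 => /eqP Zl; apply: Gs => Bl; apply: Zl.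
  by apply: Aw Bl; rewrite leqnn.
apply: ge_bigcap_nonincreasing => [m||m].
- exact: measurable_avoids_between.
- exact: nonincreasing_avoids_between.
apply: le_trans (s_le m) _.
rewrite -integral_cst; last exact: measurable_avoids_between.
apply: ge0_le_integral => //; first exact: measurable_avoids_between.
- by move=> w _; rewrite lee_fin.
- apply: measurable_monomial; [exact: discrete_generation|exact: measurable_avoids_between].
- by move=> w _; rewrite lee_fin; case/andP: (mset_monomial_itv (Z (0 + m) w) s01).
Qed.

(** Here [v n i] bounds the probability that generation [n] meets [B]; the bounds are summable, so
    the first Borel-Cantelli lemma applies. *)
Lemma extinction_of_summable_hits B (v : nat -> X -> R) (C : R) :
  (forall n l, (0 <= v n l <= 1)%R) -> (forall l, (\1_B l <= v 0 l)%R) ->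
  (forall n l, (1 - v n.+1 l <= G (fun l => 1 - v n l) l)%R) ->
  (forall N, (\sum_(n < N) v n i <= C)%R) ->
  mu.-negligible (~` extinction_event W B).
Proof.
move=> v01 v0 Gv vC; pose s n l := (1 - v n l)%R.
have s01 n l : (0 <= s n l <= 1)%R by have := v01 n l; rewrite /s; lra.
(* Stated for all [k], so that a step of the process can be traded for a step of [v]. *)
have s_le n k : (s (n + k)%N i)%:E <= \int[mu]_w (mset_monomial (s k) (Z n w))%:E.
  elim: n k => [|n IHn] k; first by rewrite integral_generation0.
  rewrite (integral_generationS (s01 k) (pastT i n)).
  rewrite addSnnS; apply: le_trans (IHn k.+1) _.
  apply: le_integral_monomial => //; first exact: (mean_monomial_itv W i (s01 k)).
  by move=> w l _ _; exact: Gv.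
have hit n : mu (~` avoids W B n) <= (v n i)%:E.
  rewrite probability_setC; last exact: measurable_avoids.
  rewrite leeBlDr//; last by rewrite fin_num_measure//; exact: measurable_avoids.
  rewrite -leeBlDl// -EFinB -[X in X <= _]/((s n i)%:E) -[n in s n]addn0.
  apply: le_trans (s_le n 0%N) _.
  rewrite -[avoids _ _ _]setTI -integral_avoids//.
  apply: le_integral_monomial => //; first exact: indic_itv.
  move=> w l _ _; have := v0 l; have := v01 0%N l.
  rewrite /s !indicE in_setC; case: (l \in B) => /=; lra.
have mA n : measurable (~` avoids W B n).
  by apply: measurableC; exact: measurable_avoids.
exists (lim_sup_set (fun n => ~` avoids W B n)); split.
- by apply: bigcapT_measurable => n; apply: bigcup_measurable => k _; exact: mA.
- apply: lim_sup_set_cvg0 => //.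
  apply: (@le_lt_trans _ _ C%:E); last by rewrite ltry.
  apply: lime_le; first by apply: is_cvg_nneseries => n _ _; exact: measure_ge0.
  apply: nearW => N; rewrite big_mkord.
  apply: (@le_trans _ _ (\sum_(n < N) (v n i)%:E)); last by rewrite sumEFin lee_fin.
  by apply: lee_sum => n _; exact: hit.
move=> w; rewrite extinction_eventE => nE n _ /=.
apply: contrapT => nA; apply: nE; exists n => // m nm.
by apply: contrapT => nAm; apply: nA; exists m.
Qed.

End InitialType.
End Criteria.

(** * Recurrence: types and sets visited infinitely often *)

Section Recurrence.
Local Open Scope ereal_scope.
Context {R : realType} {X : countType} {p : X -> {mset X}%mset -> R}.
Context {d : measure_display} {Omega : measurableType d}.
Context {P : X -> probability Omega R} (W : branching_process p P).
Local Notation Z := (generation W).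
Local Notation G := (mean_monomial p).
Implicit Types (s : X -> R) (B : set X).

(* The events that j is present at time n + m while B has been avoided since time n,
   and is hit at time n + m + 1, are disjoint for varying m. *)
Lemma extinction_of_reachable i B j : (G (\1_(~` B)) j < 1)%R ->
  (P i).-negligible (extinction_event W B `\` extinction_event W [set j]).
Proof.
set mu := P i; move=> Gj.
have s01 := indic_itv (~` B) : forall l, (0 <= (\1_(~` B) l : R) <= 1)%R.
pose e := (1 - G (\1_(~` B)) j)%R; have e0 : (0 < e)%R by rewrite subr_gt0.
pose hits m : set Omega := Z m @^-1` [set z : {mset X}%mset | j \in z].
have mhits m : measurable (hits m) by exact: (discrete_generation W m).
pose S n m := avoids_between W B n (n + m) `&` hits (n + m)%N.
have pS n m : past W i (n + m) (S n m).
  exact: (pastI [set z : {mset X}%mset | j \in z] (past_avoids_between W i B n m)).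
have mS n m : measurable (S n m) by exact: past_measurable (pS n m).
pose T n m := S n m `\` avoids W B (n + m).+1.
have mT n m : measurable (T n m) by apply: measurableD => //; exact: measurable_avoids.
(* When [j] is present, the next generation misses [B] with conditional probability at most
   [1 - e]. *)
have ST n m : e%:E * mu (S n m) <= mu (T n m).
  have mA := measurable_avoids W B (n + m).+1.
  have : mu (S n m `&` avoids W B (n + m).+1) <= (1 - e)%:E * mu (S n m).
    rewrite -integral_avoids// (integral_generationS s01 (pS n m)) -integral_cst//.
    apply: ge0_le_integral => //.
    - by move=> w _; rewrite lee_fin; apply: monomial_ge0; exact: (mean_monomial_itv W i s01).
    - apply: measurable_monomial => //; exact: discrete_generation.
    move=> w [_ jw]; rewrite lee_fin.
    rewrite (le_trans (mset_monomial_le_coord _ jw))//; first exact: (mean_monomial_itv W i s01).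
    by rewrite /e; lra.
  have -> : mu (T n m) = mu (S n m) - mu (S n m `&` avoids W B (n + m).+1).
    rewrite /T [mu (S n m)](measureDI mu (mS n m) mA) addeK//.
    by rewrite fin_num_measure//; exact: measurableI.
  rewrite -(fine_probabilityK i (measurableI _ _ (mS n m) mA)) -(fine_probabilityK i (mS n m)).
  by rewrite -EFinB -!EFinM !lee_fin; lra.
have S0 n : mu (lim_sup_set (S n)) = 0.
  apply: lim_sup_set_cvg0 => //.
  have T1 : \sum_(m <oo) mu (T n m) <= 1.
    suff <- : mu (\bigcup_m T n m) = \sum_(m <oo) mu (T n m).
      by apply: probability_le1; exact: bigcupT_measurable.
    rewrite measure_bigcup//; first by apply: eq_eseriesl => m; rewrite in_setT.
    have lt_disj m m' w : (m < m')%N -> T n m w -> T n m' w -> False.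
      move=> mm' [_ nA] [[Aw _] _]; apply: nA; apply: Aw.
      by rewrite -addnS leq_add2l mm' leq_addr.
    move=> m m' _ _ [w [Tm Tm']]; have [mm'|mm'|//] := ltngtP m m'.
      by case: (lt_disj _ _ _ mm' Tm Tm').
    by case: (lt_disj _ _ _ mm' Tm' Tm).
  (* The probabilities of [S n m] thus sum to at most [1 / e], and almost surely only finitely many
     of these events occur. *)
  have : e%:E * (\sum_(m <oo) mu (S n m)) <= 1.
    rewrite -nneseriesZl//; apply: le_trans T1; apply: lee_nneseries => m _ //.
    by rewrite mule_ge0// lee_fin ltW.
  rewrite -lee_pdivlMl// => /le_lt_trans; apply.
  by rewrite -EFinM ltry.
have mL n : measurable (lim_sup_set (S n)).
  by apply: bigcapT_measurable => m; apply: bigcup_measurable => k _.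
have nL n : mu.-negligible (lim_sup_set (S n)) by apply/negligibleP; [exact: mL|exact: S0].
apply: negligibleS (negligible_bigcup nL).
move=> w; rewrite !extinction_eventE => -[[n _ Aw] nE].
exists n => //; rewrite /lim_sup_set /bigcap /= => m _.
apply: contrapT => nS; apply: nE; exists (n + m)%N => // k mk _ ->.
apply/eqP/negPn/negP; rewrite mset_neq0 => jk; apply: nS.
have nk : (n <= k)%N := leq_trans (leq_addr _ _) mk.
exists (k - n)%N => /=; first by rewrite leq_subRL.
split; rewrite ?subnKC// /hits => l /andP[nl _]; exact: Aw.
Qed.

(** The probability of avoiding [B] in generations 0 to [m] from one individual of type [j]
    ([avoidance_iterE]). The recursion does not mention the laws, so it carries bounds under [P l]
    over to populations under [P i]. *)
Fixpoint avoidance_iter B m : X -> R :=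
  if m is m'.+1 then fun j => (\1_(~` B) j * G (avoidance_iter B m') j)%R
  else \1_(~` B).

Lemma avoidance_iter_itv (i : X) B m j : (0 <= avoidance_iter B m j <= 1)%R.
Proof.
elim: m j => [|m IHm] j /=; first exact: indic_itv.
have /andP[a0 a1] := indic_itv (R := R) (~` B) j.
have /andP[g0 g1] := mean_monomial_itv W i IHm j.
by rewrite mulr_ge0//= mulr_ile1.
Qed.

Lemma measure_avoids_between (i : X) B U n m : past W i n U ->
  P i (U `&` avoids_between W B n (n + m)) =
  \int[P i]_(w in U) (mset_monomial (avoidance_iter B m) (Z n w))%:E.
Proof.
elim: m n U => [|m IHm] n U pU.
  rewrite addn0 avoids_between_refl integral_avoids//; exact: past_measurable pU.
have pA : past W i n (U `&` avoids W B n).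
  exact: (pastI [set z | forall j, B j -> z j = 0%N] pU).
rewrite avoids_betweenS setIA (IHm _ _ (pastS pA)).
rewrite (integral_generationS (avoidance_iter_itv i B m) pA) integral_mkcondr.
apply: eq_integral => w _; rewrite patchE.
have -> : mset_monomial (avoidance_iter B m.+1) (Z n w) =
    (mset_monomial (\1_(~` B)) (Z n w) * mset_monomial (G (avoidance_iter B m)) (Z n w))%R.
  by rewrite /mset_monomial -big_split; apply: eq_bigr => l _; rewrite /= exprMn.
rewrite mset_monomial_indic; case: ifPn => [|/negP]; rewrite inE => nA.
  by rewrite asboolT// mul1r.
by rewrite asboolF// mul0r.
Qed.

Lemma avoidance_iterE (i : X) B m : (avoidance_iter B m i)%:E = P i (avoids_between W B 0 m).
Proof.
rewrite -(integral_generation0 W i (avoidance_iter_itv i B m)).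
by rewrite -[in RHS](add0n m) -[X in P i X]setTI (measure_avoids_between _ _ (pastT W i 0)).
Qed.

(* A surviving population that avoids B from time n onwards has, given its past,
   conditional probability at most 1 - e; letting n grow, the probability D of
   surviving and eventually avoiding B satisfies D <= (1 - e) D. *)
Lemma extinction_of_uniform_hitting i B (e : R) : (0 < e)%R ->
  (forall j, P j (avoids_from W B 0) <= (1 - e)%:E) ->
  (P i).-negligible (extinction_event W B `\` extinction_event W setT).
Proof.
set mu := P i; move=> e0 Be.
have e1 : (0 <= 1 - e)%R by rewrite -lee_fin; apply: le_trans (Be i); exact: measure_ge0.
pose alive n : set Omega := Z n @^-1` [set z : {mset X}%mset | z <> mset0].
pose U n m := avoids_between W B n (n + m) `&` alive (n + m)%N.
have pU n m : past W i (n + m) (U n m).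
  exact: (pastI [set z : {mset X}%mset | z <> mset0] (past_avoids_between W i B n m)).
have mU n m : measurable (U n m) by exact: past_measurable (pU n m).
have mF n := measurable_avoids_from W B n.
have conditional n m :
    mu (U n m `&` avoids_from W B (n + m)) <= (1 - e)%:E * mu (U n m).
  have dZ := discrete_generation W (n + m).
  rewrite (measure_esum_fibers i dZ (mU n m)) -esumZl//.
  rewrite (measure_esum_fibers i dZ); last exact: measurableI.
  suff fiber (z : {mset X}%mset) :
      mu (U n m `&` Z (n + m) @^-1` [set z] `&` avoids_from W B (n + m)) <=
      (1 - e)%:E * mu (U n m `&` Z (n + m) @^-1` [set z]).
    by apply: le_esum => z _; rewrite setIAC; exact: fiber.
  set V := U n m `&` _.
  have pV : past W i (n + m) V by exact: (pastI [set z] (pU n m)).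
  have mV : measurable V by exact: past_measurable pV.
  (* An empty [z] contradicts being alive; otherwise a single individual is enough, as its own
     descendants must avoid [B]. *)
  have [z0|[l lz]] : z = mset0 \/ exists l, l \in z.
    have [->|z0] := eqVneq z mset0; [by left|right].
    apply: contrapT => nz; case/negP: z0; apply/eqP/msetP => l.
    by rewrite mset0E; apply/eqP; rewrite mset_eq0; apply/negP => lz; apply: nz; exists l.
    rewrite (_ : V = set0) ?set0I ?measure0 ?mule0//.
    by apply/seteqP; split => w // [[_ aw] /= wz]; apply: aw; rewrite wz.
  rewrite muleC -(fine_probabilityK i mV).
  apply: le_trans (_ : _ <= (fine (mu V))%:E * P l (avoids_from W B 0)) _; last first.
    by rewrite lee_wpmul2l// lee_fin fine_ge0.
  rewrite [X in _ * P l X]avoids_fromE; apply: ge_bigcap_nonincreasing => [k||k].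
  - exact: measurable_avoids_between.
  - exact: nonincreasing_avoids_between.
  rewrite add0n -avoidance_iterE.
  apply: le_trans (_ : _ <= mu (V `&` avoids_between W B (n + m) (n + m + k))) _.
    rewrite le_measure ?inE//.
    - exact: measurableI.
    - by apply: measurableI => //; exact: measurable_avoids_between.
    - by move=> w [Vw Aw]; split=> // q /andP[nq _]; exact: Aw.
  rewrite (measure_avoids_between _ _ pV) (fine_probabilityK i mV) muleC -integral_cst//.
  apply: ge0_le_integral => //.
  - by move=> w _; rewrite lee_fin; apply: monomial_ge0; exact: (avoidance_iter_itv i).
  - apply: measurable_monomial => //; exact: discrete_generation.
  move=> w [_ /= ->]; rewrite lee_fin.
  by apply: mset_monomial_le_coord => //; exact: (avoidance_iter_itv i).
(* Survival forever together with avoidance of [B] from time [n] on. *)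
pose D n := \bigcap_m U n m.
have mD n : measurable (D n) by exact: bigcapT_measurable.
have D0 n : mu (D n) = 0.
  have DD : mu (D n) <= (1 - e)%:E * mu (D n).
    apply: ge_bigcap_nonincreasing => // [|m].
      move=> m m' mm'; apply/subsetPset => w [Aw aw]; split.
        exact: (subsetPset _ _ (nonincreasing_avoids_between W B n mm')).
      move=> Zm; apply: aw; rewrite (generation_mset0 _ Zm)//.
      by rewrite leq_add2l.
    apply: le_trans (conditional n m); rewrite le_measure ?inE//.
      exact: measurableI.
    move=> w Dw; split; first exact: Dw.
    move=> k nmk; have [Aw _] := Dw (k - n)%N I; apply: Aw.
    have nk := leq_trans (leq_addr _ _) nmk.
    by rewrite nk subnKC/=.
  move: DD; rewrite -(fine_probabilityK i (mD n)) -EFinM lee_fin => DD.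
  have := @fine_ge0 _ (mu (D n)) (measure_ge0 _ _) => f0.
  congr EFin; apply/eqP; rewrite eq_le f0 andbT.
  by rewrite -(pmulr_rle0 _ e0); lra.
have -> : extinction_event W B `\` extinction_event W setT = \bigcup_n D n.
  rewrite !extinction_eventE; apply/seteqP; split=> [w [[n _ Aw] nE]|w [n _ Dw]].
    exists n => // m _; split; first by move=> k /andP[nk _]; exact: Aw.
    move=> Z0; apply: nE; exists (n + m)%N => // k mk j _.
    by rewrite (generation_mset0 mk Z0) mset0E.
  split.
    exists n => // m nm; have [Aw _] := Dw (m - n)%N I; apply: Aw.
    by rewrite nm subnKC/=.
  move=> [m _ Aw]; have [_] := Dw (maxn n m - n)%N I; apply.
  apply/msetP => j; rewrite mset0E; apply: Aw => //.
  by rewrite subnKC leq_max leqnn ?orbT.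
by apply: negligible_bigcup => n; apply/negligibleP; [exact: mD|exact: D0].
Qed.

End Recurrence.

(** * The strip *)

Section PowerBounds.
Variable R : realFieldType.

Lemma bernoulli_lower (t : R) n : 0 <= t <= 1 -> 1 - n%:R * t <= (1 - t) ^+ n.
Proof.
move=> /andP[t0 t1]; elim: n => [|n IHn]; first by rewrite expr0; lra.
rewrite exprS -natr1; have n0 : 0 <= n%:R :> R by exact: ler0n.
apply: le_trans (_ : (1 - t) * (1 - n%:R * t) <= _); first by nra.
by rewrite ler_wpM2l// subr_ge0.
Qed.

(** Second-order companion of Bernoulli's inequality: the loss is quadratic in [n * t]. *)
Lemma bernoulli_upper (t : R) n : 0 <= t <= 1 ->
  (1 - t) ^+ n <= 1 - n%:R * t * (1 - n%:R * t).
Proof.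
move=> /andP[t0 t1]; elim: n => [|n IHn]; first by rewrite expr0; lra.
rewrite exprS -natr1; have n0 : 0 <= n%:R :> R by exact: ler0n.
apply: le_trans (_ : _ <= (1 - t) * (1 - n%:R * t * (1 - n%:R * t))) _.
  by rewrite ler_wpM2l// subr_ge0.
have nt : 0 <= n%:R * t by rewrite mulr_ge0.
have : 0 <= t * (n%:R * t) by rewrite mulr_ge0.
have : 0 <= t * t by rewrite mulr_ge0.
have : 0 <= t * (n%:R * t) * (n%:R * t) by rewrite !mulr_ge0.
nra.
Qed.

End PowerBounds.

Section Strip.
Variables (R : realType) (a b c x y : R).
Hypotheses (ha : 0 < a) (hb : 0 < b) (hc : 0 < c) (hy : 0 < y) (hx : 1 <= x).
Implicit Types (s v : X2 -> R) (t : X2).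
Local Notation u := ((strip_u a b c y)%:R : R).

Lemma strip_u_ge : a + b + c + y + 1 <= u.
Proof.
have := ceil_ge (a + b + c + y + 1); rewrite /strip_u => /le_trans; apply.
by rewrite natr_absz ger0_norm// ceil_ge0; move: ha hb hc hy; lra.
Qed.

Lemma strip_u_ge1 : 1 <= u.
Proof. by have := strip_u_ge; move: ha hb hc hy; lra. Qed.

Lemma strip_u_gt0 : 0 < u.
Proof. exact: lt_le_trans strip_u_ge1. Qed.

(** The mean matrix applied to [v]. The number [u] cancels: an event of probability [a / u] yields
    [u] children. *)
Definition strip_mean v t : R :=
  (if t.1 is k.+1 then a * v (k, t.2) else 0) + b * v t + c * v (t.1.+1, t.2) +
  y * x ^- t.1 * v (t.1, ~~ t.2).

Lemma strip_gfE s t :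
  strip_gf a b c x y t s = 1 - strip_mean (fun l => (1 - s l ^+ strip_u a b c y) / u) t.
Proof.
have u0 : u != 0 by rewrite gt_eqF// strip_u_gt0.
case: t => [[|k] e]; rewrite /strip_gf /strip_mean.
  by rewrite /= expr0 invr1; field.
have xk : x ^+ k.+1 != 0 by rewrite expf_neq0// gt_eqF// (lt_le_trans ltr01).
by rewrite /=; move: xk; set xk := x ^+ k.+1 => xk0; field; rewrite u0 xk0.
Qed.

Let x0 k : 0 <= x ^- k.
Proof. by rewrite invr_ge0 exprn_ge0// (le_trans ler01). Qed.

Lemma le_strip_mean v v' t : (forall l, v l <= v' l) -> strip_mean v t <= strip_mean v' t.
Proof.
move=> vv; rewrite /strip_mean; have a0 := ltW ha.
rewrite !lerD// ?ler_wpM2l ?mulr_ge0//; try exact: ltW.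
by case: t.1 => // k; rewrite ler_wpM2l.
Qed.

Lemma strip_meanZ r v t : strip_mean (fun l => r * v l) t = r * strip_mean v t.
Proof. by rewrite /strip_mean; case: t.1 => [|k]; ring. Qed.

Lemma strip_meanD v v' t :
  strip_mean (fun l => v l + v' l) t = strip_mean v t + strip_mean v' t.
Proof. by rewrite /strip_mean; case: t.1 => [|k]; ring. Qed.

Lemma strip_mean_ge0 v t : (forall l, 0 <= v l) -> 0 <= strip_mean v t.
Proof.
move=> v0; rewrite (_ : 0 = strip_mean (fun=> 0) t); first exact: le_strip_mean.
by rewrite /strip_mean; case: t.1 => [|k]; rewrite !mulr0 !addr0.
Qed.

Lemma strip_gf_lower v t : (forall l, 0 <= v l <= 1) ->
  1 - strip_mean v t <= strip_gf a b c x y t (fun l => 1 - v l).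
Proof.
move=> v01; rewrite strip_gfE lerB// le_strip_mean// => l.
have u0 := strip_u_gt0.
rewrite ler_pdivrMr//; have := bernoulli_lower (strip_u a b c y) (v01 l); lra.
Qed.

(** For [v <= D] the quadratic loss in [bernoulli_upper] costs at most the factor [1 - u * D]. *)
Lemma strip_gf_upper v (D : R) t : (forall l, 0 <= v l <= D) -> D <= 1 ->
  strip_gf a b c x y t (fun l => 1 - v l) <= 1 - (1 - u * D) * strip_mean v t.
Proof.
move=> v01 D1; rewrite strip_gfE lerB// -strip_meanZ le_strip_mean// => l.
have u0 := strip_u_gt0.
have [v0 vD] := andP (v01 l).
have := @bernoulli_upper _ (v l) (strip_u a b c y); rewrite v0 (le_trans vD D1) => /(_ isT) ub.
rewrite ler_pdivlMr//.
apply: le_trans (_ : _ <= u * v l * (1 - u * v l)) _; last by lra.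
have : 0 <= u * v l * (u * (D - v l)) by rewrite !mulr_ge0 ?subr_ge0// ltW.
lra.
Qed.

Lemma strip_gf_indic (B : set X2) t :
  strip_gf a b c x y t (\1_(~` B)) = 1 - strip_mean (\1_B) t / u.
Proof.
have u1 : (0 < strip_u a b c y)%N by rewrite -(@ltr0n R) strip_u_gt0.
rewrite strip_gfE mulrC -strip_meanZ; congr (_ - strip_mean _ _); apply/funext => l.
rewrite !indicE in_setC mulrC; case: (l \in B) => /=.
  by rewrite expr0n gtn_eqF// subr0.
by rewrite expr1n subrr.
Qed.

Lemma strip_supersolution (eta : R) : 0 < eta ->
  exists2 D : R, 0 < D <= 1 & forall v, (forall l, 0 <= v l <= 1) ->
    (forall t, (1 + eta) * v t <= strip_mean v t) ->
    forall t, strip_gf a b c x y t (fun l => 1 - D * v l) <= 1 - D * v t.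
Proof.
move=> eta0; have u1 := strip_u_ge1.
(* Chosen so that [(1 - u * D) * (1 + eta) = 1]: the gain [1 + eta] pays for the quadratic loss. *)
pose D := eta / (u * (1 + eta)).
have ue : 0 < u * (1 + eta) by nra.
have D0 : 0 < D by rewrite divr_gt0.
have D1 : D <= 1 by rewrite ler_pdivrMr//; nra.
exists D => [|v v01 vM t]; first by rewrite D0.
apply: le_trans (strip_gf_upper (v := fun l => D * v l) (D := D) _ _ D1) _.
  by move=> l; have /andP[v0 v1] := v01 l; apply/andP; split; nra.
rewrite lerB// strip_meanZ mulrCA; apply: ler_wpM2l; first exact: ltW.
have -> : 1 - u * D = (1 + eta)^-1 by rewrite /D; field; lra.
by rewrite ler_pdivlMl; [exact: vM|lra].
Qed.

End Strip.

(** * From vectors for the mean matrix to extinction probabilities *)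

Section StripProcess.
Variables (R : realType) (a b c x y : R).
Hypotheses (ha : 0 < a) (hb : 0 < b) (hc : 0 < c) (hy : 0 < y) (hx : 1 <= x).
Variable p : X2 -> {mset X2}%mset -> R.
Hypothesis hG : forall (t : X2) (s : X2 -> R), (forall l, 0 <= s l <= 1) ->
  progeny_gf p t s = (strip_gf a b c x y t s)%:E.
Variables (d : measure_display) (Omega : measurableType d).
Variables (P : X2 -> probability Omega R) (W : branching_process p P).
Implicit Types (v : X2 -> R) (t i : X2) (B : set X2).
Local Notation M := (strip_mean a b c x y).
Local Notation u := ((strip_u a b c y)%:R : R).

Let mean_monomial_strip s t : (forall l, 0 <= s l <= 1) ->
  mean_monomial p s t = strip_gf a b c x y t s.
Proof. by move=> s01; rewrite /mean_monomial hG. Qed.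

Let compl01 v : (forall l, 0 <= v l <= 1) -> forall l, 0 <= 1 - v l <= 1.
Proof. by move=> v01 l; have := v01 l; lra. Qed.

Lemma strip_extinction_le (eta : R) : 0 < eta ->
  exists2 D : R, 0 < D & forall B v, (forall l, 0 <= v l <= 1) ->
    (forall l, ~ B l -> v l = 0) -> (forall t, (1 + eta) * v t <= M v t) ->
    forall i, (P i (extinction_event W B) <= (1 - D * v i)%:E)%E.
Proof.
move=> eta0; have [D /andP[D0 D1] DM] := strip_supersolution ha hb hc hy hx eta0.
exists D => // B v v01 vB vM i.
have Dv01 l : 0 <= 1 - D * v l <= 1.
  by have /andP[v0 v1] := v01 l; apply/andP; split; nra.
apply: (extinction_le_supersolution W i (s := fun l => 1 - D * v l)) => //.
- by move=> j /vB ->; rewrite mulr0 subr0.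
- by move=> j; rewrite mean_monomial_strip//; exact: DM.
Qed.

(** The subsolution is [1 - v]; where [v t = 1] it is 0 and the inequality is trivial, hence the
    guard [v t < 1]. *)
Lemma strip_avoids_ge B v i : (forall l, 0 <= v l <= 1) ->
  (forall l, B l -> v l = 1) -> (forall t, ~ B t -> v t < 1 -> M v t <= v t) ->
  ((1 - v i)%:E <= P i (avoids_from W B 0))%E.
Proof.
move=> v01 vB vM; apply: (avoids_ge_subsolution W i (s := fun l => 1 - v l)).
- exact: compl01.
- by move=> j /vB ->; rewrite subrr.
move=> j Bj; rewrite mean_monomial_strip; last exact: compl01.
have /andP[v0] := v01 j; rewrite le_eqVlt => /orP[/eqP vj|vj].
  rewrite vj subrr -mean_monomial_strip; last exact: compl01.
  by case/andP: (mean_monomial_itv W i (compl01 v01) j).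
by apply: le_trans (strip_gf_lower ha hb hc hy hx j v01); rewrite lerB// vM.
Qed.

Lemma strip_reachable B i t : 0 < M (\1_B) t ->
  (P i).-negligible (extinction_event W B `\` extinction_event W [set t]).
Proof.
move=> M0; apply: extinction_of_reachable.
rewrite mean_monomial_strip; last exact: indic_itv.
rewrite (strip_gf_indic ha hb hc hy hx) gtrDl oppr_lt0 divr_gt0//.
exact: (strip_u_gt0 ha hb hc hy).
Qed.

Let negligible_trans (mu : probability Omega R) (A B C : set Omega) :
  mu.-negligible (A `\` B) -> mu.-negligible (B `\` C) -> mu.-negligible (A `\` C).
Proof.
move=> AB BC; apply: negligibleS (negligibleU AB BC) => w [Aw nC].
by have [Bw|nB] := pselect (B w); [right|left].
Qed.

Definition level0 : set X2 := [set t | t.1 = 0%N].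

Lemma finite_levels n : finite_set [set t : X2 | (t.1 < n)%N].
Proof.
apply: (@sub_finite_set _ _ (`I_n `*` [set: bool])).
  by move=> [k e] /= kn; split.
by apply: finite_setX; [exact: finite_II|exact: finite_finset].
Qed.

Lemma partial_extinction_level0 :
  partial_extinction_event W `<=` extinction_event W level0.
Proof.
apply: partial_extinction_event_sub; apply: sub_finite_set (finite_levels 1).
by move=> [k e]; rewrite /level0 /= => ->.
Qed.

(** A type at level [k.+1] can have children at level [k] on its line, since [a > 0]; by induction
    on the level, every type almost surely dies out if level 0 does. *)
Lemma strip_irreducible i :
  (P i).-negligible (extinction_event W level0 `\` partial_extinction_event W).
Proof.
have x0 k : 0 <= x ^- k by rewrite invr_ge0 exprn_ge0// (le_trans ler01).
have step k e :
    (P i).-negligible (extinction_event W level0 `\` extinction_event W [set (k, e)]).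
  elim: k => [|k IHk].
    rewrite (_ : _ `\` _ = set0); first exact: negligible_set0.
    rewrite -subset0 => w [w0 wE]; apply: wE.
    by apply: sub_extinction_event w0 => _ ->.
  apply: negligible_trans IHk (strip_reachable _ _).
  have i0 l : 0 <= (\1_[set (k, e)] l : R) by case/andP: (indic_itv (R := R) [set (k, e)] l).
  rewrite /strip_mean /= [X in a * X](_ : _ = 1) ?mulr1; last by rewrite indicE mem_set.
  rewrite -!addrA ltr_wpDr//; repeat apply: addr_ge0; apply: mulr_ge0 => //; try exact: ltW.
  by apply: mulr_ge0 => //; exact: ltW.
apply: negligibleS (negligible_bigcup_countType (F := fun t =>
    extinction_event W level0 `\` extinction_event W [set t]) _).
  rewrite partial_extinction_eventE => w [w0 /existsNP[t /not_implyP[_ wt]]].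
  by exists t.
by move=> [k e]; exact: step.
Qed.

End StripProcess.

(** * Explicit vectors on the strip *)

Section StripEstimates.
Variables (R : realType) (a b c x y : R).
Hypotheses (ha : 0 < a) (hb : 0 < b) (hc : 0 < c) (hy : 0 < y) (hx : 1 <= x).
Variable p : X2 -> {mset X2}%mset -> R.
Hypothesis hG : forall (t : X2) (s : X2 -> R), (forall l, 0 <= s l <= 1) ->
  progeny_gf p t s = (strip_gf a b c x y t s)%:E.
Variables (d : measure_display) (Omega : measurableType d).
Variables (P : X2 -> probability Omega R) (W : branching_process p P).
Implicit Types (v : X2 -> R) (t i : X2) (B : set X2).
Local Notation M := (strip_mean a b c x y).

Lemma geometric_le (g r e : R) : 0 <= g < 1 -> 0 <= r -> 0 < e ->
  exists K, forall k, (K <= k)%N -> r * g ^+ k <= e.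
Proof.
move=> /andP[g0 g1] r0 e0.
have : (fun k => r * g ^+ k) @ \oo --> (r * 0 : R).
  by apply: cvgMr; apply: cvg_expr; rewrite ger0_norm.
rewrite mulr0 => /cvgrPdist_le /(_ _ e0) [K _ Ke]; exists K => k Kk.
have := Ke k Kk; rewrite /= sub0r normrN ger0_norm// mulr_ge0// exprn_ge0//.
Qed.

(** Only the individuals on the line are counted. The vector is at least [1 - th] on all of it, so
    the bound is uniform in the starting level. *)
Lemma line_extinction_le : a < c -> 1 < a + b + c ->
  exists2 D : R, 0 < D & forall k e,
    (P (k, e) (extinction_event W (type_line e)) <= (1 - D)%:E)%E.
Proof.
move=> ac S1; have eta0 : 0 < a + b + c - 1 by lra.
have [D D0 DP] := strip_extinction_le ha hb hc hy hx hG W eta0.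
pose th := a / c.
have cth : a = c * th by rewrite /th mulrC divfK// gt_eqF.
have th0 : 0 < th by rewrite divr_gt0.
have th1 : th < 1 by rewrite ltr_pdivrMr// mul1r.
clearbody th.
have thk k : 0 <= th ^+ k <= 1 by rewrite exprn_ge0 ?exprn_ile1 ?ltW.
exists (D * (1 - th)) => [|k e]; first by rewrite mulr_gt0// subr_gt0.
(* On the integers, 1 and [th ^+ k] are both eigenvectors with eigenvalue [a + b + c]. The shift by
   one makes [v] vanish at the fictitious level -1, which accounts for the missing link below level
   0. *)
pose v t := if t.2 == e then 1 - th ^+ t.1.+1 else 0.
have v01 l : 0 <= v l <= 1.
  by rewrite /v; case: eqP => _; [have := thk l.1.+1|]; lra.
have := DP (type_line e) v v01 _ _ (k, e); rewrite /v eqxx => H.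
apply: le_trans (H _ _) _.
- by rewrite /type_line /= => l /eqP/negPf ->.
- have nee : (~~ e == e) = false by clear; case: e.
  have v0 l : 0 <= v l by case/andP: (v01 l).
  move=> [j e']; have [-> /=|ne] := eqVneq e' e; last first.
    by rewrite /= ?(negPf ne) mulr0; apply: strip_mean_ge0.
  rewrite /strip_mean /= eqxx nee mulr0 addr0.
  case: j => [|j]; rewrite ?expr1 ?exprS ?expr0.
    have E1 : c * th * th = a * th by rewrite -cth.
    lra.
  set T := th ^+ j.
  have E1 : c * th * (th * (th * T)) = a * (th * (th * T)) by rewrite -cth.
  have E2 : c * th * (th * T) = a * (th * T) by rewrite -cth.
  lra.
- rewrite lee_fin /=; have : th ^+ k.+1 <= th by rewrite ler_iXnr// ltW.
  nra.
Qed.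

(* Where the vector is 1 nothing has to be checked, so no condition is put on the
   levels up to K, in which the y-links may be too strong. *)
Lemma avoids_level0_ge (g : R) : 1 < x -> 0 < g < 1 -> a / g + b + c * g < 1 ->
  exists K, forall k e,
    ((1 - g ^+ (k - K))%:E <= P (k, e) (avoids_from W level0 0))%E.
Proof.
move=> x1 /andP[g0 g1] rho1; have x0 : 0 < x by lra.
have xi : 0 <= x^-1 < 1 by rewrite invr_ge0 ltW//= invf_lt1.
have rho0 : 0 < 1 - (a / g + b + c * g) by lra.
(* From level [K] on, the y-link is at most the slack left by the moves along the line. *)
have [K HK] := geometric_le xi (ltW hy) rho0.
exists K => k e.
pose v t := g ^+ (t.1 - K).
have v01 l : 0 <= v l <= 1 by rewrite exprn_ge0 ?exprn_ile1 ?ltW.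
apply: (strip_avoids_ge ha hb hc hy hx hG W (k, e) v01).
  by move=> [j e']; rewrite /v /level0 /= => ->.
move=> [j e'] _; rewrite /v /strip_mean /=.
have [jK|Kj] := leqP j K; first by rewrite (eqP (jK : (j - K)%N == 0%N)) expr0 ltxx.
move=> _; case: j Kj => [//|j]; rewrite ltnS => Kj.
have := HK j.+1 (leqW Kj); rewrite exprVn -(subnKC Kj) -!addnS !addKn.
set q := y / x ^+ _ => Hq; rewrite !exprS; set T := g ^+ _.
have gT : 0 <= g * T by rewrite mulr_ge0 ?exprn_ge0 ?ltW.
have aT : a * T = a / g * (g * T) by rewrite mulrA divfK// gt_eqF.
have : 0 <= (1 - (a / g + b + c * g) - q) * (g * T) by rewrite mulr_ge0// subr_ge0.
rewrite aT; lra.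
Qed.

(** A y-link at level [k] costs [y * x ^- k], as [v] is 1 on the other line. Since [x^-1 <= g], this
    is at most [y * g ^+ K] times [g ^+ (k - K)], and [K] makes [y * g ^+ K] at most the slack
    [1 - (a / g + b + c * g)]. *)
Lemma avoids_line_ge (g : R) e : 0 < g < 1 -> x^-1 <= g -> a / g + b + c * g < 1 ->
  exists K, forall k,
    ((1 - g ^+ (k - K))%:E <= P (k, e) (avoids_from W (type_line (~~ e)) 0))%E.
Proof.
move=> /andP[g0 g1] xg rho1; have x0 : 0 < x by exact: lt_le_trans hx.
have gi : 0 <= g < 1 by rewrite ltW.
have rho0 : 0 < 1 - (a / g + b + c * g) by lra.
have [K HK] := geometric_le gi (ltW hy) rho0; exists K => k.
pose v t := if t.2 == e then g ^+ (t.1 - K) else 1.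
have v01 l : 0 <= v l <= 1.
  by rewrite /v; case: ifP => _; rewrite ?ler01 ?lexx ?exprn_ge0 ?exprn_ile1 ?ltW.
have nee : (~~ e == e) = false by clear; case: e.
have := strip_avoids_ge ha hb hc hy hx hG W (B := type_line (~~ e)) (k, e) v01.
rewrite [v (k, e)]/v eqxx; apply.
  by move=> [j e']; rewrite /v /type_line /= => ->; rewrite nee.
move=> [j e']; rewrite /v /type_line /strip_mean /= => /eqP.
have -> : (e' != ~~ e) = (e' == e) by clear; case: e'; case: e.
move=> /eqP -> {e'}; rewrite eqxx nee.
have [jK|Kj] := leqP j K; first by rewrite (eqP (jK : (j - K)%N == 0%N)) expr0 ltxx.
move=> _; case: j Kj => [//|j]; rewrite ltnS => Kj.
have := HK K (leqnn K); rewrite -(subnKC Kj) -!addnS !addKn.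
set i := (j - K)%N => HKK; have : x ^- (K + i.+1) <= g ^+ K * g ^+ i.+1.
  by rewrite -exprD -exprVn lerXn2r// nnegrE ?invr_ge0 ltW.
rewrite mulr1 !exprS; set T := g ^+ i; set xk := _^-1 => xkg.
have gT : 0 <= g * T by rewrite mulr_ge0 ?exprn_ge0 ?ltW.
have aT : a * T = a / g * (g * T) by rewrite mulrA divfK// gt_eqF.
have : 0 <= (1 - (a / g + b + c * g) - y * g ^+ K) * (g * T) by rewrite mulr_ge0// subr_ge0.
have : y * xk <= y * (g ^+ K * (g * T)) by rewrite ler_wpM2l// ltW.
rewrite aT; lra.
Qed.

End StripEstimates.

(** * The homogeneous strip, [x = 1] *)

Section HomogeneousStrip.
Variables (R : realType) (a b c y : R).
Hypotheses (ha : 0 < a) (hb : 0 < b) (hc : 0 < c) (hy : 0 < y).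
Variable p : X2 -> {mset X2}%mset -> R.
Hypothesis hG : forall (t : X2) (s : X2 -> R), (forall l, 0 <= s l <= 1) ->
  progeny_gf p t s = (strip_gf a b c 1 y t s)%:E.
Variables (d : measure_display) (Omega : measurableType d).
Variables (P : X2 -> probability Omega R) (W : branching_process p P).
Implicit Types (v : X2 -> R) (t i : X2) (B : set X2).
Local Notation M := (strip_mean a b c 1 y).
Local Notation u := ((strip_u a b c y)%:R : R).
Local Notation w := (Num.sqrt (a * c)).

Let h1 : (1 : R) <= 1. Proof. exact: lexx. Qed.

Let w0 : 0 < w. Proof. by rewrite sqrtr_gt0 mulr_gt0. Qed.

Let ww : w * w = a * c.
Proof. by rewrite -expr2 sqr_sqrtr// mulr_ge0// ltW. Qed.

(** With [f = w / c], the square root of [a / c], tilting by powers of [f] turns both vertical rates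
    into [w]: [c * f = w] and [f * w = a]. *)
Let cf : c * (w / c) = w. Proof. by rewrite mulrC divfK// gt_eqF. Qed.

Let fw : w / c * w = a. Proof. by rewrite mulrAC ww mulfK// gt_eqF. Qed.

Lemma sqrt_ratio_itv : a < c -> 0 < w / c < 1.
Proof.
move=> ac; rewrite divr_gt0//= ltr_pdivrMr// mul1r.
rewrite -(@ltr_pXn2r _ 2)// ?nnegrE ?ltW// expr2 ww expr2 ltr_pM2r//.
Qed.

Lemma strip_mean_sum (N : nat) (V : nat -> X2 -> R) t :
  M (fun l => \sum_(n < N) V n l) t = \sum_(n < N) M (V n) t.
Proof.
elim: N => [|N IHN].
  under eq_fun do rewrite big_ord0.
  by rewrite big_ord0 /strip_mean; case: t.1 => [|k]; rewrite !mulr0 !addr0.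
under eq_fun do rewrite big_ord_recr/=.
by rewrite strip_meanD IHN big_ord_recr.
Qed.

(** The expected total number of visits to level 0 is finite: the partial sums satisfy
    [S N.+1 = \1_level0 + M (S N)], and [h] dominates this recursion up to the factor [w]. *)
Lemma level0_extinction i : a < c -> b + y + 2 * w <= 1 ->
  (P i).-negligible (~` extinction_event W level0).
Proof.
move=> ac byw; have /andP[f0 f1] := sqrt_ratio_itv ac.
set f := w / c in f0 f1; have cf' : c * f = w := cf; have fw' : f * w = a := fw.
clearbody f.
pose U n := iter n (fun v => M v) (\1_level0 : X2 -> R).
have U0 n l : 0 <= U n l.
  elim: n l => [|n IHn] l; first by case/andP: (indic_itv (R := R) level0 l).
  exact: (strip_mean_ge0 ha hb hc hy h1).
pose S N l := \sum_(n < N) U n l.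
have SS N l : S N.+1 l = \1_level0 l + M (S N) l.
  rewrite /S big_ord_recl; congr (_ + _).
  by rewrite (strip_mean_sum N U).
pose h t : R := f ^+ t.1.
(* At level 0 the missing downward link leaves room for the source term [w]. *)
have Mh t : w * \1_level0 t + M h t <= h t.
  case: t => [[|k] e]; rewrite /strip_mean /h indicE.
    by rewrite mem_set//= invr1 !mulr1 !expr1 add0r cf'; lra.
  rewrite memNset//= mulr0 add0r expr1n invr1 mulr1.
  rewrite !exprS; set T := f ^+ k; have T0 : 0 <= T by rewrite exprn_ge0// ltW.
  have E1 : c * (f * (f * T)) = w * (f * T) by rewrite -cf'; ring.
  have E2 : a * T = w * (f * T) by rewrite mulrCA mulrA fw'.
  have : 0 <= (1 - (b + y + 2 * w)) * (f * T).
    by rewrite mulr_ge0 ?subr_ge0// mulr_ge0// ltW.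
  rewrite E1 E2; lra.
have Sh N l : w * S N l <= h l.
  elim: N l => [|N IHN] l; first by rewrite /S big_ord0 mulr0 exprn_ge0// ltW.
  apply: le_trans (Mh l); rewrite SS mulrDr lerD2l -strip_meanZ.
  exact: (le_strip_mean ha hb hc hy h1).
(* The iterates may exceed 1 and are cut off; where the cut acts, the required inequality is
   trivial. *)
pose v n l := Num.min 1 (U n l).
have v01 n l : 0 <= v n l <= 1 by rewrite ge_min lexx le_min ler01 U0.
apply: (extinction_of_summable_hits W (v := v) (C := h i / w)) => //.
- move=> l; rewrite /v le_min lexx andbT.
  by case/andP: (indic_itv (R := R) level0 l).
- move=> n l; have s01 j : 0 <= 1 - v n j <= 1 by have := v01 n j; lra.
  rewrite lerBlDr /v minElt; case: ifP => _.
    by rewrite lerDr; case/andP: (mean_monomial_itv W i s01 l).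
  rewrite /mean_monomial hG//= -lerBlDr.
  apply: le_trans (strip_gf_lower ha hb hc hy h1 l (v01 n)).
  rewrite lerB// (le_strip_mean ha hb hc hy h1)// => j.
  by rewrite ge_min lexx orbT.
- move=> N; apply: le_trans (_ : S N i <= _).
    by apply: ler_sum => n _; rewrite ge_min lexx orbT.
  by rewrite ler_pdivlMr// mulrC.
Qed.

(** For [x = 1] the y-links do not weaken with the level: an individual off the line has children on
    it with probability at least [y / u]. *)
Lemma one_line_extinction e i :
  (P i).-negligible (extinction_event W (type_line e) `\` extinction_event W [set: X2]).
Proof.
have u0 : 0 < u := strip_u_gt0 ha hb hc hy.
apply: (extinction_of_uniform_hitting (e := y / u) i (divr_gt0 hy u0)).
move=> j; apply: le_trans (_ : _ <= P j (avoids_between W (type_line e) 0 (0 + 1)))%E _.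
  rewrite le_measure ?inE//.
  - exact: measurable_avoids_from.
  - exact: measurable_avoids_between.
  - by move=> z Aw k _; exact: Aw.
rewrite -avoidance_iterE lee_fin /=.
have yu : y / u <= 1.
  rewrite ler_pdivrMr// mul1r; have := strip_u_ge ha hb hc hy.
  by move: ha hb hc hy; lra.
rewrite /mean_monomial hG /=; last exact: indic_itv.
rewrite (strip_gf_indic ha hb hc hy h1) indicE.
have [je|je] := pselect (type_line e j); first by rewrite memNset// mul0r subr_ge0.
rewrite mem_set// mul1r lerB// ler_pM2r ?invr_gt0//.
have i0 l : 0 <= (\1_(type_line e) l : R) by case/andP: (indic_itv (R := R) (type_line e) l).
rewrite /strip_mean expr1n invr1 mulr1.
have -> : \1_(type_line e) (j.1, ~~ j.2) = 1 :> R.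
  rewrite indicE mem_set//; move: je; rewrite /type_line /=.
  by clear; case: j.2; case: e.
rewrite mulr1 lerDr !addr_ge0// ?mulr_ge0// ?(ltW hb) ?(ltW hc)//.
by case: j.1 => // k; rewrite mulr_ge0// ltW.
Qed.

(* On a window of N - 1 levels the discrete parabola j (N - j), tilted by powers of
   sqrt (a / c), is a strict subsolution of the mean matrix as soon as N is large. *)
Lemma partial_extinction_le : a < c -> 1 < b + y + 2 * w ->
  exists2 D : R, 0 < D & forall t, (P t (partial_extinction_event W) <= (1 - D)%:E)%E.
Proof.
move=> ac byw; have /andP[f0 f1] := sqrt_ratio_itv ac.
set f := w / c in f0 f1; have cf' : c * f = w := cf; have fw' : f * w = a := fw.
clearbody f.
pose gam := b + y + 2 * w - 1.
have gam0 : 0 < gam by rewrite /gam; lra.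
have eta0 : 0 < gam / 2 by lra.
have [D D0 DP] := strip_extinction_le ha hb hc hy h1 hG W eta0.
(* The curvature of the parabola costs [2 * w], while the excess [gam / 2] gains at least
   [n0 * gam / 2] inside the window. *)
have [n0 n0w] : exists n0 : nat, 4 * w <= n0%:R * gam.
  by exists (Num.truncn (4 * w / gam)).+1; rewrite -ler_pdivrMr// ltW// truncnS_gt.
pose N := n0.+2.
have N0 : 0 < N%:R :> R by rewrite ltr0n.
have NN0 : 0 < N%:R ^+ 2 :> R by rewrite exprn_gt0.
(* Truncated subtraction makes [q] vanish at 0 and from [N] on. *)
pose q (j : nat) : R := (j * (N - j))%:R.
have q0 j : 0 <= q j by rewrite ler0n.
have qN j : q j <= N%:R ^+ 2.
  rewrite -natrX ler_nat expnS expn1; case: (leqP j N) => jN.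
    by rewrite leq_mul// leq_subr.
  by rewrite (eqP (ltnW jN : (N - j)%N == 0%N)) muln0.
exists (D * (q 1%N / N%:R ^+ 2)).
  by rewrite mulr_gt0// divr_gt0// /q mul1n ltr0n subn_gt0.
move=> [m e].
(* The window starts at the initial level [m], which receives the value [q 1]; the resulting bound
   does not depend on [m]. *)
pose V (l : X2) : R := f ^+ (l.1 - m) * q (l.1.+1 - m)%N.
have V0 l : 0 <= V l by rewrite mulr_ge0// exprn_ge0// ltW.
pose v l := (N%:R ^+ 2)^-1 * V l.
have v01 l : 0 <= v l <= 1.
  rewrite /v mulr_ge0 ?invr_ge0 ?(ltW NN0)//= mulrC ler_pdivrMr// mul1r.
  apply: le_trans (qN (l.1.+1 - m)%N).
  by rewrite ler_piMl// exprn_ile1// ltW.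
have -> : q 1%N / N%:R ^+ 2 = v (m, e) by rewrite /v /V /= subnn subSnn expr0 mul1r mulrC.
have finB := finite_levels (m + N).
apply: le_trans (_ : _ <= P (m, e) (extinction_event W [set t | (t.1 < m + N)%N]))%E _.
  rewrite le_measure ?inE//.
  - exact: measurable_partial_extinction_event.
  - exact: measurable_extinction_event.
  - exact: partial_extinction_event_sub.
apply: DP => // [[k e'] /= /negP|[k e']].
  rewrite -leqNgt => mk; rewrite /v /V /q /=.
  have -> : (N - (k.+1 - m) = 0)%N.
    by apply/eqP; rewrite subn_eq0 leq_subRL ?(leq_trans (leq_addr _ _) (leqW mk))// leqW.
  by rewrite muln0 !mulr0.
rewrite /v strip_meanZ mulrCA ler_wpM2l ?invr_ge0 ?(ltW NN0)//.
have trivial_case : V (k, e') = 0 -> (1 + gam / 2) * V (k, e') <= M V (k, e').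
  by move=> ->; rewrite mulr0; exact: (strip_mean_ge0 ha hb hc hy h1).
have [km|mk] := ltnP k m.
  by apply: trivial_case; rewrite /V /= (eqP (km : (k.+1 - m)%N == 0%N)) /q mul0n mulr0.
pose i := (k - m)%N; have kE : k = (m + i)%N by rewrite subnKC.
have [iN|Ni] := ltnP i.+1 N; last first.
  apply: trivial_case; rewrite /V /= subSn// -/i /q (_ : (N - i.+1 = 0)%N) ?muln0 ?mulr0//.
  exact/eqP.
pose n := (N - i.+2)%N; have NE : N = (i.+2 + n)%N by rewrite subnKC.
have qi0 : q i = i%:R * (n%:R + 2).
  by rewrite /q NE addSn addSn -addnS -addnS addKn natrM -[n.+2]addn2 natrD.
have qi1 : q i.+1 = (i%:R + 1) * (n%:R + 1).
  by rewrite /q NE addSn -addnS addKn natrM -!natr1.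
have qi2 : q i.+2 = (i%:R + 2) * n%:R.
  by rewrite /q NE addKn natrM -[i.+2]addn2 natrD.
have n0E : n0%:R = i%:R + n%:R :> R.
  by rewrite -natrD; congr _%:R; move: NE; rewrite /N addSn addSn => -[].
have i0 : 0 <= i%:R :> R := ler0n _ _; have nn0 : 0 <= n%:R :> R := ler0n _ _.
have T0 : 0 < f ^+ i by rewrite exprn_gt0.
pose dn := if k is k'.+1 then a * V (k', e') else 0.
have ME : M V (k, e') = dn + b * V (k, e') + c * V (k.+1, e') + y * V (k, ~~ e').
  by rewrite /strip_mean /= expr1n invr1 mulr1.
(* An equality inside the window; at its lower edge the left side is 0, whether or not a level lies
   below. *)
have down : w * f ^+ i * q i <= dn.
  rewrite /dn; case: (k) kE mk => [|k'] kE mk.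
    have -> : i = 0%N by apply/eqP; move/esym/eqP: kE; rewrite addn_eq0 => /andP[].
    by rewrite /q mul0n mulr0.
  case: (i) kE => [|i'] kE.
    by rewrite /q mul0n mulr0 mulr_ge0// ltW.
  have -> : k' = (m + i')%N by move: kE; rewrite addnS => -[].
  rewrite /V /= -addnS !addKn exprS.
  have aE r : a * r = w * f * r by rewrite [w * f]mulrC fw'.
  by rewrite [leRHS]aE -!mulrA.
have k1 : (k.+1 - m = i.+1)%N by rewrite subSn.
have k2 : (k.+2 - m = i.+2)%N by rewrite subSn ?k1// leqW.
rewrite ME /V /= k1 k2 -/i exprS; apply: le_trans (_ : _ <=
    w * f ^+ i * q i + (b + y) * (f ^+ i * q i.+1) + w * (f ^+ i * q i.+2)) _.
  have -> : (1 + gam / 2) * (f ^+ i * q i.+1) =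
    f ^+ i * ((1 + gam / 2) * q i.+1) by rewrite mulrCA.
  have -> : w * f ^+ i * q i + (b + y) * (f ^+ i * q i.+1) + w * (f ^+ i * q i.+2) =
    f ^+ i * (w * (q i + q i.+2) + (b + y) * q i.+1) by ring.
  rewrite ler_wpM2l ?(ltW T0)//.
  have -> : q i + q i.+2 = 2 * q i.+1 - 2 by rewrite qi0 qi1 qi2; ring.
  have : n0%:R * gam <= q i.+1 * gam.
    by rewrite ler_wpM2r ?(ltW gam0)// n0E qi1; nra.
  by rewrite /gam in n0w *; lra.
have -> : c * (f * f ^+ i * q i.+2) = w * (f ^+ i * q i.+2) by rewrite -cf'; ring.
lra.
Qed.

(** By irreducibility, extinction of level 0 is no more likely than partial extinction, so level 0
    is hit with probability at least [D] from every type. *)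
Lemma level0_recurrence i : a < c -> 1 < b + y + 2 * w ->
  (P i).-negligible (extinction_event W level0 `\` extinction_event W [set: X2]).
Proof.
move=> ac byw; have [D D0 DP] := partial_extinction_le ac byw.
apply: (extinction_of_uniform_hitting (e := D) i D0) => j.
apply: le_trans (_ : _ <= P j (extinction_event W level0))%E _.
  rewrite le_measure ?inE//.
  - exact: measurable_avoids_from.
  - exact: measurable_extinction_event.
  - by rewrite extinction_eventE => z Az; exists 0%N.
apply: le_trans (DP j).
have mE := measurable_extinction_event W level0.
have mPE := measurable_partial_extinction_event W.
have := le_fine_probability mE mPE (strip_irreducible ha hb hc hy h1 hG W j).
by rewrite -lee_fin !fine_probabilityK.
Qed.

End HomogeneousStrip.

(** * Consequences of [1 < mu] *)

Section DriftFacts.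
Variables (R : realType) (a b c mu : R).
Hypotheses (ha : 0 < a) (hc : 0 < c).
Hypothesis hbac : b + 2 * Num.sqrt (a * c) < 1.
Hypothesis hmu : mu = (1 - b - Num.sqrt ((1 - b) ^+ 2 - 4 * a * c)) / (2 * a).
Hypothesis hmu1 : 1 < mu.

(* mu is the smaller root of the convex quadratic [a z^2 - (1 - b) z + c], which is
   negative strictly between its roots and positive at 1 < mu. *)
Lemma drift_facts : [/\ a < c, 1 < a + b + c &
  forall x, mu < x -> exists2 z, 1 < z <= x & a * z + b + c / z < 1].
Proof.
have a0 := ha; have c0 := hc; have m1 := hmu1.
have : Num.sqrt (a * c) ^+ 2 = a * c by rewrite sqr_sqrtr// mulr_ge0// ltW.
have : 0 <= Num.sqrt (a * c) by exact: sqrtr_ge0.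
move: hbac; set w := Num.sqrt (a * c); clearbody w => bw w0 ww.
have disc1 : 0 < (1 - b) ^+ 2 - 4 * a * c.
  have : 0 < (1 - b - 2 * w) * (1 - b + 2 * w) by rewrite mulr_gt0; lra.
  lra.
have disc0 := ltW disc1.
have := sqr_sqrtr disc0; have := sqrtr_ge0 ((1 - b) ^+ 2 - 4 * a * c).
move: hmu; set r := Num.sqrt (_ - _) => muE r0 rr.
have a2 : 0 < 2 * a by lra.
have mua : mu * (2 * a) = 1 - b - r by rewrite muE divfK// gt_eqF.
have : 2 * a < mu * (2 * a) by rewrite ltr_pMl.
rewrite mua => rlt.
have S1 : 1 < a + b + c.
  have : 0 < (1 - b - 2 * a - r) * (1 - b - 2 * a + r) by rewrite mulr_gt0; lra.
  (* Up to the factor [4 * a], this is the value of the quadratic at 1. *)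
  have -> : (1 - b - 2 * a - r) * (1 - b - 2 * a + r) = 4 * a * (a + b + c - 1).
    have : (1 - b - 2 * a - r) * (1 - b - 2 * a + r) = (1 - b - 2 * a) ^+ 2 - r ^+ 2 by ring.
    by rewrite rr => ->; ring.
  by rewrite pmulr_rgt0 ?subr_gt0// mulr_gt0.
have rpos : 0 < r by rewrite sqrtr_gt0.
split => //; first by lra.
(* As [x] may lie beyond the larger root, it is cut off at the vertex, which keeps [z] between the
   roots. *)
move=> x mux; pose z := Num.min x ((1 - b) / (2 * a)).
have zx : z <= x by rewrite ge_min lexx.
have z1 : 2 * a * z <= 1 - b.
  by rewrite mulrC -ler_pdivlMr// ge_min lexx orbT.
have muz : mu < z.
  by rewrite lt_min mux ltr_pdivlMr// mua; lra.
have zpos : 1 < z by exact: lt_trans muz.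
exists z; first by rewrite zpos zx.
have z2 : 1 - b - r < 2 * a * z by rewrite -mua mulrC ltr_pM2l.
have z0 : 0 < z by lra.
have quad : a * z ^+ 2 - (1 - b) * z + c < 0.
  have : 0 < (r - (2 * a * z - (1 - b))) * (r + (2 * a * z - (1 - b))) by rewrite mulr_gt0; lra.
  have : (r - (2 * a * z - (1 - b))) * (r + (2 * a * z - (1 - b))) =
    r ^+ 2 - (2 * a * z - (1 - b)) ^+ 2 by ring.
  rewrite rr => -> H; have : 4 * a * (a * z ^+ 2 - (1 - b) * z + c) < 0 by lra.
  by rewrite pmulr_rlt0// mulr_gt0.
rewrite -subr_lt0 -(pmulr_llt0 _ z0).
by rewrite (_ : _ * z = a * z ^+ 2 - (1 - b) * z + c)//; field; rewrite gt_eqF.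
Qed.

End DriftFacts.

(** * Comparison of the extinction probabilities in the four cases *)

Lemma lt_fine_probability d (T : measurableType d) (R : realType)
    (mu : probability T R) (A B : set T) (D e : R) :
  measurable A -> measurable B ->
  (mu A <= (1 - D)%:E)%E -> ((1 - e)%:E <= mu B)%E -> e < D ->
  fine (mu A) < fine (mu B).
Proof.
move=> mA mB AD eB De; rewrite -lte_fin !fineK ?fin_num_measure//.
apply: le_lt_trans AD (lt_le_trans _ eB).
by rewrite lte_fin ltrD2l ltrN2.
Qed.

Theorem proposition2 (R : realType) (a b c x y : R)
    (ha : 0 < a) (hb : 0 < b) (hc : 0 < c) (hy : 0 < y) (hx : 1 <= x)
    (p : X2 -> {mset X2}%mset -> R) (hp : offspring_distribution p)
    (hG : forall (t : X2) (s : X2 -> R), (forall l, 0 <= s l <= 1) ->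
       progeny_gf p t s = (strip_gf a b c x y t s)%:E)
    (d : measure_display) (Omega : measurableType d)
    (P : X2 -> probability Omega R) (W : branching_process p P)
    (hbac : b + 2 * Num.sqrt (a * c) < 1)
    (mu : R)
    (hmu : mu = (1 - b - Num.sqrt ((1 - b) ^+ 2 - 4 * a * c)) / (2 * a))
    (hmu1 : 1 < mu) :
  let q := global_extinction_probability W in
  let qA1 := extinction_probability W (type_line false) in
  let qA2 := extinction_probability W (type_line true) in
  let qt := partial_extinction_probability W in
  let one : X2 -> R := fun=> 1 in
  [/\ x = 1 -> b + y + 2 * Num.sqrt (a * c) <= 1 ->
        [/\ q = qA1, qA1 = qA2, vec_lt qA2 qt & qt = one],
      x = 1 -> 1 < b + y + 2 * Num.sqrt (a * c) ->
        [/\ q = qA1, qA1 = qA2, qA2 = qt & vec_lt qt one],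
      1 < x -> vec_lt q qt
    & mu < x ->
        (vec_lt q qA1 /\ vec_lt qA1 qt) /\ (vec_lt q qA2 /\ vec_lt qA2 qt)].
Proof.
move=> q qA1 qA2 qt one.
have [ac S1 zE] := drift_facts ha hc hbac hmu hmu1.
set w := Num.sqrt (a * c) in hbac.
have [D D0 lineD] := line_extinction_le ha hb hc hy hx hG W ac S1.
have mE A := measurable_extinction_event W A.
have mPE := measurable_partial_extinction_event W.
have le_prob i A B : measurable A -> measurable B -> (P i).-negligible (A `\` B) ->
  fine (P i A) <= fine (P i B) by exact: le_fine_probability.
have le_sub i A B : measurable A -> measurable B -> A `<=` B -> fine (P i A) <= fine (P i B).
  move=> mA mB AB; apply: le_prob => //; rewrite (_ : _ `\` _ = set0).
    exact: negligible_set0.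
  by rewrite -subset0 => z [/AB].
have ext_sub A : extinction_event W [set: X2] `<=` extinction_event W A.
  exact: sub_extinction_event.
have globalD k e : (P (k, e) (extinction_event W [set: X2]) <= (1 - D)%:E)%E.
  by apply: le_trans (lineD k e); rewrite le_measure ?inE//; exact: ext_sub.
have global_partial : extinction_event W [set: X2] `<=` partial_extinction_event W.
  by rewrite partial_extinction_eventE => z Ez t _; exact: ext_sub Ez.
(* From a high level the error falls below the survival margin [D]; this gives the strict
   inequalities when [x > 1]. *)
have pow_lt g K : 0 < g < 1 -> exists k, g ^+ (k - K) < D.
  move=> /andP[g0 g1]; have gi : 0 <= g < 1 by rewrite ltW.
  have D2 : 0 < D / 2 by rewrite divr_gt0.
  have [K' HK'] := geometric_le gi ler01 D2.
  exists (K + K')%N; rewrite addKn; have := HK' K' (leqnn _); lra.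
have x1_line e : x = 1 -> extinction_probability W (type_line e) = q.
  move=> x1; move: hG; rewrite x1 => hG1.
  apply/funext => i; apply/eqP; rewrite eq_le; apply/andP; split.
    apply: le_prob => //; exact: (one_line_extinction ha hb hc hy hG1 W e i).
  by apply: le_sub => //; exact: ext_sub.
have wf := sqrt_ratio_itv ha hc ac; rewrite -/w in wf.
(* At [g = w / c] both vertical terms equal [w], so the sum is [b + 2 * w]. *)
have rho : a / (w / c) + b + c * (w / c) < 1.
  have w0 : 0 < w by rewrite sqrtr_gt0 mulr_gt0.
  have ww : w * w = a * c by rewrite -expr2 sqr_sqrtr// mulr_ge0// ltW.
  have -> : a / (w / c) = w by rewrite invf_div mulrA -ww mulfK// gt_eqF.
  have -> : c * (w / c) = w by rewrite mulrC divfK// gt_eqF.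
  lra.
have le_measure_sub i A B : measurable A -> measurable B -> A `<=` B -> (P i A <= P i B)%E.
  by move=> mA mB AB; rewrite le_measure ?inE.
have partial_ge : 1 < x -> exists K, forall k e,
    ((1 - (w / c) ^+ (k - K))%:E <= P (k, e) (partial_extinction_event W))%E.
  move=> x1; have [K HK] := avoids_level0_ge ha hb hc hy hx hG W x1 wf rho.
  exists K => k e; apply: le_trans (HK k e) _.
  apply: (@le_trans _ _ (P (k, e) (extinction_event W level0))).
    apply: le_measure_sub => //; first exact: measurable_avoids_from.
    by rewrite extinction_eventE => z Az; exists 0%N.
  have := le_prob (k, e) _ _ (mE level0) mPE (strip_irreducible ha hb hc hy hx hG W (k, e)).
  by rewrite -lee_fin !fine_probabilityK.
have q_le_qt i : q i <= qt i by exact: le_sub.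
split.
- move=> x1 byw; have qtE : qt = one.
    apply/funext => i; rewrite /qt /partial_extinction_probability /one.
    apply/eqP; rewrite eq_le; apply/andP; split.
      by rewrite -lee_fin fine_probabilityK//; exact: probability_le1.
    rewrite (_ : 1 = fine (P i [set: Omega])); last by rewrite probability_setT.
    apply: le_prob => //; move: hG; rewrite x1 => hG1.
    have := strip_irreducible ha hb hc hy (lexx 1) hG1 W i.
    have := level0_extinction ha hb hc hy hG1 W i ac byw => n1 n2.
    (* Without partial extinction, either level 0 does not die out or some type outlives it; both
       events are null. *)
    apply: negligibleS (negligibleU n1 n2) => z [_ nz].
    by have [l0|l0] := pselect (extinction_event W level0 z); [right|left].
  split => //; first by rewrite /qA1 x1_line.
    by rewrite /qA1 /qA2 !x1_line.
  rewrite qtE; split=> [i|]; first by rewrite -qtE /qA2 x1_line.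
  exists (0%N, true); rewrite -qtE; apply: (lt_fine_probability (D := D) (e := 0)) => //.
  by rewrite subr0 -(fine_probabilityK (0%N, true) mPE) -[fine _]/(qt (0%N, true)) qtE.
- move=> x1 byw; move: hG; rewrite x1 => hG1.
  have qqt : q = qt.
    apply/funext => i; apply/eqP; rewrite eq_le q_le_qt /=.
    apply: le_prob => //.
    apply: negligibleS (level0_recurrence ha hb hc hy hG1 W i ac byw) => z [Pz nz].
    by split=> //; exact: partial_extinction_level0.
  split.
  + by rewrite /qA1 x1_line.
  + by rewrite /qA1 /qA2 !x1_line.
  + by rewrite /qA2 x1_line.
  have lt1 i : qt i < 1.
    rewrite -qqt; apply: le_lt_trans (_ : 1 - D < 1); last by lra.
    rewrite -lee_fin fine_probabilityK//; case: i => k e; exact: globalD.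
  split=> [i|]; first exact: ltW.
  by exists (0%N, true).
- move=> x1; split=> //; have [K HK] := partial_ge x1; have [k kD] := pow_lt _ K wf.
  by exists (k, true); exact: (lt_fine_probability (mE _) mPE (globalD k true) (HK k true) kD).
- move=> mux; have [z /andP[z1 zx] zrho] := zE x mux.
  have x1 : 1 < x by exact: lt_le_trans zx.
  have x0 : 0 < x by exact: lt_trans x1.
  have z0 : 0 < z by exact: lt_trans z1.
  (* With [g = z^-1] the sum [a / g + b + c * g] becomes [a * z + b + c / z], and [z <= x] gives
     [x^-1 <= g]. *)
  have g01 : 0 < z^-1 < 1 by rewrite invr_gt0 z0 invf_lt1.
  have xg : x^-1 <= z^-1 by rewrite lef_pV2 ?posrE.
  have grho : a / z^-1 + b + c * z^-1 < 1 by rewrite invrK.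
  have [K HK] := partial_ge x1; have [k kD] := pow_lt _ K wf.
  suff both e : vec_lt q (extinction_probability W (type_line e)) /\
      vec_lt (extinction_probability W (type_line e)) qt by split; exact: both.
  split; split.
  + by move=> i; apply: le_sub => //; exact: ext_sub.
  (* From high up on the other line, the line [e] is never visited with probability above [1 - D],
     whereas global extinction has probability at most [1 - D]. *)
  + have [K' HK'] := avoids_line_ge ha hb hc hy hx hG W (~~ e) g01 xg grho.
    have [k' kD'] := pow_lt _ K' g01; exists (k', ~~ e).
    apply: (lt_fine_probability (mE _) (mE _) (globalD _ _) _ kD').
    apply: le_trans (HK' k') _; rewrite negbK; apply: le_measure_sub => //.
      exact: measurable_avoids_from.
    by rewrite extinction_eventE => t At; exists 0%N.
  (* Each type off the line [e] has possible children on it, so it almost surely dies out if the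
     line does. *)
  + move=> i; apply: le_prob => //.
    rewrite partial_extinction_eventE setDE setC_bigcap setI_bigcupr.
    apply: negligible_bigcup_countType => -[j e']; rewrite -setDE.
    have [->|ne] := eqVneq e' e.
      rewrite (_ : _ `\` _ = set0); first exact: negligible_set0.
      rewrite -subset0 => t [Et nt]; apply: nt.
      by apply: sub_extinction_event Et => _ ->.
    apply: (strip_reachable ha hb hc hy hx hG W).
    have i0 l : 0 <= (\1_(type_line e) l : R).
      by case/andP: (indic_itv (R := R) (type_line e) l).
    rewrite /strip_mean /=.
    have -> : \1_(type_line e) (j, ~~ e') = 1 :> R.
      by rewrite indicE mem_set// /type_line /=; case: (e') ne; case: (e).
    rewrite mulr1 ltr_wpDl ?divr_gt0 ?exprn_gt0// !addr_ge0 ?mulr_ge0 ?(ltW hb) ?(ltW hc)//.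
    by case: j => // j'; rewrite mulr_ge0// ltW.
  (* From high up on the line [e] itself, that line dies out with probability at most [1 - D], and
     partial extinction has a larger probability. *)
  + by exists (k, e); exact: (lt_fine_probability (mE _) mPE (lineD k e) (HK k e) kD).
Qed.
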